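(* (i) Let $R$ be a Noetherian ring and $M$ a finitely generated $R$-module (of finite dimension). If the non-zero factors of the dimension filtration of $M$ are clean, then $M$ is pretty clean. (ii) Conversely, assume that $R$ is a Cohen-Macaulay ring which is either a Noetherian local ring or a standard graded $K$-algebra ($K$ a field), that $R$ has a canonical module $\omega_R$, and that the finitely generated $R$-module $M$ (graded, if $R$ is graded) admits a pretty clean filtration $\mathcal{F}$ such that $R/P$ is Cohen-Macaulay for all $P\in\operatorname{Supp}(\mathcal{F})$. Then the non-zero factors of the dimension filtration of $M$ are clean.
   Context: Let $R$ be a Noetherian ring and $M$ a finitely generated $R$-module. A prime filtration of $M$ is a finite filtration $\mathcal{F}: 0=M_0\subset M_1\subset\cdots\subset M_r=M$ by submodules with $M_i/M_{i-1}\cong R/P_i$, $P_i$ a prime ideal, for $i=1,\dots,r$; set $\operatorname{Supp}(\mathcal{F})=\{P_1,\dots,P_r\}$. The filtration $\mathcal{F}$ is clean if $\operatorname{Supp}(\mathcal{F})\subset \operatorname{Min}(M)$ (the set of minimal primes of $\operatorname{Supp}(M)$), and pretty clean if for all $i<j$ with $P_i\subset P_j$ one has $P_i=P_j$. $M$ is called clean (pretty clean) if it admits a clean (pretty clean) filtration. If $d=\dim M<\infty$, the dimension filtration of $M$ is $0\subset D_0(M)\subset D_1(M)\subset\cdots\subset D_d(M)=M$, where $D_i(M)$ is the largest submodule of $M$ with $\dim D_i(M)\le i$; set $D_{-1}(M)=0$. Its factors are the modules $D_i(M)/D_{i-1}(M)$, $i=0,\dots,d$. *)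

(* Defs.v *)
From HB Require Import structures.
From mathcomp Require Import all_boot all_order all_algebra ring_quotient.
From mathcomp Require Import boolp.

Set Implicit Arguments.
Unset Strict Implicit.
Unset Printing Implicit Defensive.

Import GRing.Theory.
Local Open Scope ring_scope.
Local Open Scope quotient_scope.

(* Submodules, proper ideals and prime ideals are the library's
   [submodClosed V], [idealr R] and [prime_idealr R].  These are boolean
   predicates; with the classical axioms of [boolp] they describe all
   submodules, all proper ideals and all primes. *)

Section Submodules.
Variables (R : comNzRingType) (V : lmodType R).

Record submod (N : submodClosed V) : Type :=
  Submod { submod_val : V; submod_valP : submod_val \in N }.

HB.instance Definition _ (N : submodClosed V) :=
  [isSub for @submod_val N].
HB.instance Definition _ (N : submodClosed V) := [Choice of submod N by <:].
HB.instance Definition _ (N : submodClosed V) :=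
  [SubChoice_isSubLmodule of submod N by <:].

Definition zero_pred : {pred V} := fun x => x == 0.
Fact zero_pred_closed : subsemimod_closed zero_pred.
Proof.
split; last by move=> a u; rewrite !unfold_in => /eqP ->; rewrite scaler0.
split; first by rewrite unfold_in eqxx.
by move=> u v; rewrite !unfold_in => /eqP -> /eqP ->; rewrite addr0.
Qed.
HB.instance Definition _ :=
  GRing.isSubSemiModClosed.Build R V zero_pred zero_pred_closed.
Definition zero_submod : submodClosed V := zero_pred.

End Submodules.

Section Quotients.
Variables (R : comNzRingType) (V : lmodType R) (N : submodClosed V).

(* [N] as an additive subgroup, the argument of the library's quotient. *)
Definition submod_pred : {pred V} := fun x => x \in N.
Fact submod_pred_closed : zmod_closed submod_pred.
Proof. exact: GRing.submod_closedB (submodClosedP N). Qed.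
HB.instance Definition _ :=
  GRing.isZmodClosed.Build V submod_pred submod_pred_closed.

Definition quotmod : Type := Quotient.quot (submod_pred : zmodClosed V).
HB.instance Definition _ := GRing.Zmodule.on quotmod.
HB.instance Definition _ := EqQuotient.on quotmod.

Definition quotmod_scale (a : R) (x : quotmod) : quotmod :=
  \pi_quotmod (a *: repr x).

Lemma quotmod_eq (x y : V) : (\pi_quotmod x == \pi_quotmod y) = (x - y \in N).
Proof. exact/esym/(Quotient.idealrBE (submod_pred : zmodClosed V)). Qed.

Lemma pi_quotmod_scale a x :
  \pi_quotmod (a *: x) = quotmod_scale a (\pi_quotmod x).
Proof.
apply/eqP; rewrite quotmod_eq -scalerBr rpredZ // -quotmod_eq.
by rewrite reprK.
Qed.

Lemma pi_quotmodD x y :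
  \pi_quotmod (x + y) = \pi_quotmod x + \pi_quotmod y.
Proof. exact: (raddfD \pi_quotmod). Qed.

Fact quotmod_scaleA a b x :
  quotmod_scale a (quotmod_scale b x) = quotmod_scale (a * b) x.
Proof.
rewrite -[x]reprK; move: (repr x) => v.
by rewrite -(pi_quotmod_scale b v) -!pi_quotmod_scale scalerA.
Qed.
Fact quotmod_scale1 : left_id 1 quotmod_scale.
Proof. by move=> x; rewrite -[x]reprK -!pi_quotmod_scale scale1r. Qed.
Fact quotmod_scaleDr : right_distributive quotmod_scale +%R.
Proof.
move=> a x y; rewrite -[x]reprK -[y]reprK -pi_quotmodD -!pi_quotmod_scale.
by rewrite scalerDr pi_quotmodD.
Qed.
Fact quotmod_scaleDl x : {morph quotmod_scale^~ x : a b / a + b}.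
Proof.
move=> a b; rewrite -[x]reprK -!pi_quotmod_scale.
by rewrite scalerDl pi_quotmodD.
Qed.
HB.instance Definition _ := GRing.Zmodule_isLmodule.Build R quotmod
  quotmod_scaleA quotmod_scale1 quotmod_scaleDr quotmod_scaleDl.

End Quotients.

Section Subquotients.
Variables (R : comNzRingType) (V : lmodType R) (N N' : submodClosed V).

Definition restr_pred : {pred submod N} := fun u => val u \in N'.
Fact restr_predE u : (u \in restr_pred) = (val u \in N').
Proof. by []. Qed.
Fact restr_pred_closed : subsemimod_closed restr_pred.
Proof.
split; last by move=> a u; rewrite !restr_predE linearZ => Nu; rewrite rpredZ.
split; first by rewrite restr_predE raddf0 rpred0.
by move=> u v; rewrite !restr_predE raddfD => Nu Nv; rewrite rpredD.
Qed.
HB.instance Definition _ :=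
  GRing.isSubSemiModClosed.Build R (submod N) restr_pred restr_pred_closed.

(* N / (N :&: N'), i.e. N / N' when N' is contained in N *)
Definition subquot : lmodType R := quotmod (restr_pred : submodClosed (submod N)).

End Subquotients.

Section LinearMaps.
Variables (R : comNzRingType) (U V : lmodType R) (f : {linear U -> V}).

Definition ker_pred : {pred U} := fun x => f x == 0.
Fact ker_pred_closed : subsemimod_closed ker_pred.
Proof.
split; last first.
  by move=> a u; rewrite !unfold_in linearZZ => /eqP ->; rewrite scaler0.
split; first by rewrite unfold_in linear0.
by move=> u v; rewrite !unfold_in linearD => /eqP -> /eqP ->; rewrite addr0.
Qed.
HB.instance Definition _ :=
  GRing.isSubSemiModClosed.Build R U ker_pred ker_pred_closed.
Definition ker : submodClosed U := ker_pred.

Definition im_pred : {pred V} := fun y => `[< exists x, y = f x >].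
Fact im_pred_closed : subsemimod_closed im_pred.
Proof.
split; last first.
  move=> a u; rewrite !unfold_in => /asboolP[x ->]; apply/asboolP.
  by exists (a *: x); rewrite linearZZ.
split; first by rewrite unfold_in; apply/asboolP; exists 0; rewrite linear0.
move=> u v; rewrite !unfold_in => /asboolP[x ->] /asboolP[y ->].
by apply/asboolP; exists (x + y); rewrite linearD.
Qed.
HB.instance Definition _ :=
  GRing.isSubSemiModClosed.Build R V im_pred im_pred_closed.
Definition im : submodClosed V := im_pred.

End LinearMaps.

Section ResidueModule.
Variables (R : comNzRingType) (I : idealr R).

Definition ideal_quot_scale (a : R) (x : {ideal_quot I}) : {ideal_quot I} :=
  \pi_{ideal_quot I} a * x.

Fact ideal_quot_scaleA a b x :
  ideal_quot_scale a (ideal_quot_scale b x) = ideal_quot_scale (a * b) x.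
Proof. by rewrite /ideal_quot_scale rmorphM mulrA. Qed.
Fact ideal_quot_scale1 : left_id 1 ideal_quot_scale.
Proof. by move=> x; rewrite /ideal_quot_scale rmorph1 mul1r. Qed.
Fact ideal_quot_scaleDr : right_distributive ideal_quot_scale +%R.
Proof. by move=> a x y; rewrite /ideal_quot_scale mulrDr. Qed.
Fact ideal_quot_scaleDl x : {morph ideal_quot_scale^~ x : a b / a + b}.
Proof. by move=> a b; rewrite /ideal_quot_scale rmorphD mulrDl. Qed.
HB.instance Definition _ := GRing.Zmodule_isLmodule.Build R {ideal_quot I}
  ideal_quot_scaleA ideal_quot_scale1 ideal_quot_scaleDr ideal_quot_scaleDl.

End ResidueModule.

Definition mod_iso (R : comNzRingType) (U V : lmodType R) : Prop :=
  exists f : {linear U -> V}, bijective f.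

Definition nonzero_mod (R : comNzRingType) (V : lmodType R) : Prop :=
  exists x : V, x != 0.

Definition fin_gen (R : comNzRingType) (V : lmodType R) : Prop :=
  exists s : seq V, forall x : V,
    exists c : nat -> R, x = \sum_(i < size s) c i *: s`_i.

Definition noetherian (R : comNzRingType) : Prop :=
  forall I : submodClosed R^o, fin_gen (submod I).

Definition maximal_ideal (R : comNzRingType) (m : prime_idealr R) : Prop :=
  forall I : idealr R, {subset m <= I} -> {subset I <= m}.

Definition is_local (R : comNzRingType) (m : prime_idealr R) : Prop :=
  maximal_ideal m /\ forall n : prime_idealr R, maximal_ideal n -> n =i m.

(* The localization of [V] at [p] is nonzero iff some [x : V] is not killed by
   any element outside [p]. *)
Definition in_supp (R : comNzRingType) (V : lmodType R) (p : prime_idealr R) :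
    Prop :=
  exists x : V, forall s, s \notin p -> s *: x != 0.

Definition in_min (R : comNzRingType) (V : lmodType R) (p : prime_idealr R) :
    Prop :=
  in_supp V p /\
  forall q : prime_idealr R, in_supp V q -> {subset q <= p} -> q =i p.

Definition supp_chain (R : comNzRingType) (V : lmodType R)
    (c : nat -> prime_idealr R) (k : nat) : Prop :=
  (forall i, (i <= k)%N -> in_supp V (c i)) /\
  (forall i, (i < k)%N -> {subset c i <= c i.+1} /\ ~ (c i =i c i.+1)).

(* Holds for the zero module and every [n]. *)
Definition dim_le (R : comNzRingType) (V : lmodType R) (n : nat) : Prop :=
  forall c k, supp_chain V c k -> (k <= n)%N.

Definition dim_eq (R : comNzRingType) (V : lmodType R) (n : nat) : Prop :=
  dim_le V n /\ exists c, supp_chain V c n.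

Definition finite_dim (R : comNzRingType) (V : lmodType R) : Prop :=
  exists n, dim_le V n.

(* [pf_sub i] is M_i for i <= r = [pf_len] (other values are irrelevant) and
   [pf_prime i] is P_(i+1), as M_(i+1) / M_i is isomorphic to R / P_(i+1). *)
Record prime_filtration (R : comNzRingType) (V : lmodType R) : Type :=
  PrimeFiltration {
    pf_len : nat;
    pf_sub : nat -> submodClosed V;
    pf_prime : 'I_pf_len -> prime_idealr R;
    pf_bot : pf_sub 0%N =i pred1 0;
    pf_top : pf_sub pf_len =i predT;
    pf_le : forall i : 'I_pf_len, {subset pf_sub i <= pf_sub i.+1};
    pf_factor : forall i : 'I_pf_len,
      mod_iso (subquot (pf_sub i.+1) (pf_sub i)) {ideal_quot (pf_prime i)}
  }.
Arguments pf_prime {R V} _ _.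

Definition clean_filtration (R : comNzRingType) (V : lmodType R)
    (F : prime_filtration V) : Prop :=
  forall i, in_min V (pf_prime F i).

Definition pretty_clean_filtration (R : comNzRingType) (V : lmodType R)
    (F : prime_filtration V) : Prop :=
  forall i j : 'I_(pf_len F), (i < j)%N ->
    {subset pf_prime F i <= pf_prime F j} -> pf_prime F i =i pf_prime F j.

Definition clean (R : comNzRingType) (V : lmodType R) : Prop :=
  exists F : prime_filtration V, clean_filtration F.

Definition pretty_clean (R : comNzRingType) (V : lmodType R) : Prop :=
  exists F : prime_filtration V, pretty_clean_filtration F.

(* [D i] is D_i(V) for every natural number i; it is V from i = dim V on. *)
Definition dimension_filtration (R : comNzRingType) (V : lmodType R)
    (D : nat -> submodClosed V) : Prop :=
  forall i, dim_le (submod (D i)) i /\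
    forall N : submodClosed V, dim_le (submod N) i -> {subset N <= D i}.

(* D_i(V) / D_(i-1)(V), with D_(-1)(V) = 0 *)
Definition dim_factor (R : comNzRingType) (V : lmodType R)
    (D : nat -> submodClosed V) (i : nat) : lmodType R :=
  subquot (D i) (if i is j.+1 then D j else zero_submod V).

Definition dim_factors_clean (R : comNzRingType) (V : lmodType R)
    (D : nat -> submodClosed V) : Prop :=
  forall i, nonzero_mod (dim_factor D i) -> clean (dim_factor D i).

(* x lies in (s_0, ..., s_(k-1)) V, k = size s *)
Definition in_seq_mul (R : comNzRingType) (V : lmodType R) (s : seq R) (x : V) :
    Prop :=
  exists v : nat -> V, x = \sum_(i < size s) s`_i *: v i.

Definition regular_seq (R : comNzRingType) (V : lmodType R) (s : seq R) : Prop :=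
  (forall i, (i < size s)%N -> forall x : V,
     in_seq_mul (take i s) (s`_i *: x) -> in_seq_mul (take i s) x) /\
  (exists x : V, ~ in_seq_mul s x).

Definition depth_eq (R : comNzRingType) (m : prime_idealr R) (V : lmodType R)
    (n : nat) : Prop :=
  (exists s : seq R, [/\ {subset s <= m}, regular_seq V s & size s = n]) /\
  (forall s : seq R, {subset s <= m} -> regular_seq V s -> (size s <= n)%N).

Definition cohen_macaulay_local (R : comNzRingType) : Prop :=
  exists m : prime_idealr R, is_local m /\
    exists n, depth_eq m (R^o : lmodType R) n /\ dim_eq (R^o : lmodType R) n.

(* [phi] exhibits [S] as the localization of [R] at [p]. *)
Definition is_localization (R S : comNzRingType) (p : prime_idealr R)
    (phi : {rmorphism R -> S}) : Prop :=
  [/\ forall s, s \notin p -> exists t, phi s * t = 1,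
      forall x, exists a s, s \notin p /\ x * phi s = phi a
    & forall a, phi a = 0 <-> exists s, s \notin p /\ s * a = 0].

Definition cohen_macaulay (R : comNzRingType) : Prop :=
  noetherian R /\
  forall m : prime_idealr R, maximal_ideal m ->
    exists (S : comNzRingType) (phi : {rmorphism R -> S}),
      is_localization m phi /\ cohen_macaulay_local S.

(* A resolution of [N] by the free modules of rows R^(b i); the differential
   R^(b i.+1) -> R^(b i) is right multiplication by [A i]. *)
Definition free_resolution (R : comNzRingType) (N : lmodType R) (b : nat -> nat)
    (A : forall i, 'M[R]_(b i.+1, b i)) : Prop :=
  exists e : {linear 'rV[R]_(b 0%N) -> N},
  [/\ forall y, exists v, e v = y,
      forall v, e v = 0 <-> exists w, v = w *m A 0%N
    & forall i (v : 'rV[R]_(b i.+1)), v *m A i = 0 <-> exists w, v = w *m A i.+1].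

Section HomDifferential.
Variables (R : comNzRingType) (V : lmodType R) (p q : nat) (A : 'M[R]_(p, q)).

(* Hom(R^q, V) -> Hom(R^p, V), precomposition with [mulmxr A], where a map
   R^q -> V is given by its values on the standard basis. *)
Definition hom_diff (c : {ffun 'I_q -> V}) : {ffun 'I_p -> V} :=
  [ffun j => \sum_k A j k *: c k].
Fact hom_diff_is_linear : linear hom_diff.
Proof.
move=> a c c'; apply/ffunP => j; rewrite !ffunE scaler_sumr -big_split /=.
apply: eq_bigr => k _; rewrite !ffunE scalerDr; congr (_ + _).
by rewrite !scalerA mulrC.
Qed.
HB.instance Definition _ :=
  GRing.isLinear.Build R {ffun 'I_q -> V} {ffun 'I_p -> V} _ hom_diff
    hom_diff_is_linear.

End HomDifferential.

(* Ext^i(N, V), computed from the free resolution [A] of [N] *)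
Definition Ext (R : comNzRingType) (V : lmodType R) (b : nat -> nat)
    (A : forall i, 'M[R]_(b i.+1, b i)) (i : nat) : lmodType R :=
  subquot (ker (hom_diff (V := V) (A i)))
    (match i return submodClosed {ffun 'I_(b i) -> V} with
     | 0%N => zero_submod _
     | j.+1 => im (hom_diff (V := V) (A j))
     end).

Definition injective_mod (R : comNzRingType) (E : lmodType R) : Prop :=
  forall (U V : lmodType R) (f : {linear U -> V}) (g : {linear U -> E}),
    injective f -> exists h : {linear V -> E}, forall u, h (f u) = g u.

Definition finite_injective_dim (R : comNzRingType) (V : lmodType R) : Prop :=
  exists (n : nat) (E : nat -> lmodType R) (e : {linear V -> E 0%N})
    (d : forall i, {linear E i -> E i.+1}),
  [/\ forall i, injective_mod (E i),
      forall i, (n < i)%N -> ~ nonzero_mod (E i),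
      injective e,
      forall x, d 0%N x = 0 <-> exists v, x = e v
    & forall i x, d i.+1 x = 0 <-> exists y, x = d i y].

(* A maximal Cohen-Macaulay module of type 1 and of finite injective dimension
   over the local ring (R, m) [Bruns-Herzog, Cohen-Macaulay rings, 3.3.1]. *)
Definition canonical_module_local (R : comNzRingType) (m : prime_idealr R)
    (W : lmodType R) : Prop :=
  [/\ fin_gen W,
      finite_injective_dim W
    & exists n, [/\ depth_eq m W n, dim_eq W n, dim_eq (R^o : lmodType R) n
      & exists b (A : forall i, 'M[R]_(b i.+1, b i)),
          free_resolution {ideal_quot m} A /\
          mod_iso (Ext W A n) {ideal_quot m}]].

(* [V] is the direct sum of the subgroups [G i]. *)
Definition direct_sum (I : eqType) (V : zmodType) (G : I -> zmodClosed V) :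
    Prop :=
  (forall x : V, exists (s : seq I) (f : I -> V),
     (forall i, f i \in G i) /\ x = \sum_(i <- s) f i) /\
  (forall (s : seq I) (f : I -> V), uniq s -> (forall i, f i \in G i) ->
     \sum_(i <- s) f i = 0 -> forall i, i \in s -> f i = 0).

(* R = K[R_1] with R_0 = K and R_1 spanned by finitely many elements; [iota] is
   the structure map of the K-algebra R and [G i] is R_i. *)
Definition standard_graded (K : fieldType) (R : comNzRingType)
    (iota : {rmorphism K -> R}) (G : nat -> zmodClosed R) : Prop :=
  [/\ direct_sum G,
      forall i j x y, x \in G i -> y \in G j -> x * y \in G (i + j)%N,
      forall x, x \in G 0%N <-> exists a, x = iota a
    & exists s : seq R, {subset s <= G 1%N} /\
        forall S : subringClosed R,
          (forall a, iota a \in S) -> {subset s <= S} -> S =i predT].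

Definition graded_module (R : comNzRingType) (G : nat -> zmodClosed R)
    (V : lmodType R) : Prop :=
  exists H : int -> zmodClosed V, direct_sum H /\
    forall i j a x, a \in G i -> x \in H j -> a *: x \in H (i%:Z + j).

(* [m] is the sum of the R_i with i > 0. *)
Definition irrelevant_ideal (R : comNzRingType) (G : nat -> zmodClosed R)
    (m : prime_idealr R) : Prop :=
  forall x, x \in m <-> exists (s : seq nat) (f : nat -> R),
    [/\ all (fun i => 0 < i)%N s, forall i, f i \in G i
      & x = \sum_(i <- s) f i].

(* A graded module W with Ext^i(R/m, W) = 0 for i != d and Ext^d(R/m, W)
   isomorphic to R/m, where d = dim R [Bruns-Herzog, 3.6.8].  The isomorphism
   for i = d is not required to have degree 0: this determines W only up to a
   shift of its grading, which is immaterial for the existence of W. *)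
Definition canonical_module_graded (R : comNzRingType)
    (G : nat -> zmodClosed R) (W : lmodType R) : Prop :=
  [/\ graded_module G W,
      fin_gen W
    & exists (m : prime_idealr R) (d : nat),
      [/\ irrelevant_ideal G m, dim_eq (R^o : lmodType R) d
        & exists b (A : forall i, 'M[R]_(b i.+1, b i)),
          [/\ free_resolution {ideal_quot m} A,
              mod_iso (Ext W A d) {ideal_quot m}
            & forall i, i != d -> ~ nonzero_mod (Ext W A i)]]].

(* Main.v *)
(* Swapping two adjacent factors R/P, R/Q of a prime filtration is possible when
   Ext^1(R/Q, R/P) = 0, that is, when every homomorphism Q -> R/P is a
   multiplication.  By Ischebeck's theorem this holds if R/P is Cohen-Macaulay,
   dim R/Q < dim R/P and P is not contained in Q: then P + Q strictly contains Q,
   so that dim R/(P + Q) + 2 <= dim R/P.  Hence a pretty clean filtration as in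
   (ii) can be sorted by dim R/P_i; the D_i(M) are members of the sorted
   filtration, and the primes between D_(i-1)(M) and D_i(M) all have dimension i,
   so none of them strictly contains another prime of the support.

   In the graded case the primes of the filtration are associated primes of M,
   hence graded, which reduces the vanishing of Ext^1 to the localization at the
   irrelevant ideal m.  That dim R/P is the height of m/P follows from
   ht p <= ht p* + 1, where p* is the largest graded ideal contained in p.

   For (i), a prime P of a clean filtration of D_i(M)/D_(i-1)(M) is an associated
   prime, so dim R/P <= i, and dim R/P < i would contradict the maximality of
   D_(i-1)(M).  Hence the concatenated filtration is pretty clean. *)
From HB Require Import structures.
Require Import Defs.
From mathcomp Require Import all_boot all_order all_algebra ring_quotient.
From mathcomp Require Import boolp ring zify.

Set Implicit Arguments.
Unset Strict Implicit.
Unset Printing Implicit Defensive.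

Import GRing.Theory.
Local Open Scope ring_scope.
Local Open Scope quotient_scope.

(** Cohen-Macaulayness provides depth only in the localization [S] of R/P at m/P, while factors are
    exchanged over [R]; this gap shapes part (ii). Two bridges are needed: a chain of dim R/P steps
    above P has to fit below m, so that depth S >= dim R/P, and a multiplier found in [S], which
    describes only [t * f] with t outside m, has to be turned into one for [f]. Both are immediate
    over a local ring; over a graded one they rest on P and Q being graded. Classes in Ext^1(R/I,
    R/Z) are maps on [I], linear modulo [Z], up to multiplications. Ischebeck's theorem is an
    induction on depth: nonvanishing at a prime p survives division by a regular z outside p, since
    otherwise every class would be z times another one, against Nakayama's lemma; an ideal maximal
    among those with nonvanishing is prime, and gives the next, strictly larger prime of a chain.
    For Ext^1 in depth n only n - 1 steps come out; the step from Q to a prime over P + Q makes up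
    for it. *)

Lemma not_subsetP (T : Type) (A B : {pred T}) :
  ~ {subset A <= B} -> exists2 z, z \in A & z \notin B.
Proof.
move=> nAB; apply: contrapT => nex; apply: nAB => z Az.
by apply: contrapT => /negP nBz; apply: nex; exists z.
Qed.

(** * Ideals and the ascending chain condition *)

Section Submodules.
Variables (R : comNzRingType) (V : lmodType R).
Implicit Types X : V -> Prop.

Definition submodule X :=
  [/\ X 0, forall x y, X x -> X y -> X (x + y) & forall a x, X x -> X (a *: x)].

Lemma submodule_submodClosed X : submodule X ->
  exists N : submodClosed V, forall x, (x \in N) <-> X x.
Proof.
move=> [X0 XD XZ].
pose P : {pred V} := fun x => `[< X x >].
have PE x : (x \in P) = `[< X x >] by [].
have cP : subsemimod_closed P.
  split; last by move=> a u; rewrite !PE => /asboolP Xu; apply/asboolP/XZ.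
  split; first by rewrite PE; apply/asboolP.
  by move=> u v; rewrite !PE => /asboolP Xu /asboolP Xv; apply/asboolP/XD.
pose Q : submodClosed V := HB.pack P (GRing.isSubSemiModClosed.Build R V P cP).
exists Q => x.
by change ((x \in P) <-> X x); rewrite PE; split=> /asboolP.
Qed.

Lemma submodClosed_submodule (N : submodClosed V) : submodule (fun x => x \in N).
Proof. by split=> *; rewrite ?rpred0 ?rpredD ?rpredZ. Qed.

Lemma submod_valZ (N : submodClosed V) a (u : submod N) :
  submod_val (a *: u) = a *: submod_val u.
Proof. exact: (linearZZ (val : submod N -> V)). Qed.

Lemma submod_valB (N : submodClosed V) (u v : submod N) :
  submod_val (u - v) = submod_val u - submod_val v.
Proof. exact: (raddfB (val : submod N -> V)). Qed.

Lemma submod_val0 (N : submodClosed V) : submod_val (0 : submod N) = 0.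
Proof. exact: (raddf0 (val : submod N -> V)). Qed.

Lemma submod_val_sum (N : submodClosed V) (I : Type) (s : seq I)
    (f : I -> submod N) :
  submod_val (\sum_(i <- s) f i) = \sum_(i <- s) submod_val (f i).
Proof. exact: (raddf_sum (val : submod N -> V)). Qed.

End Submodules.

Section Ideals.
Variable R : comNzRingType.
Implicit Types I J Z : R -> Prop.

Definition ideal I :=
  [/\ I 0, forall x y, I x -> I y -> I (x + y) & forall a x, I x -> I (a * x)].

Lemma idealN I x : ideal I -> I x -> I (- x).
Proof. by case=> _ _ IM Ix; rewrite -mulN1r; apply: IM. Qed.

Lemma idealB I x y : ideal I -> I x -> I y -> I (x - y).
Proof. by move=> idI Ix Iy; case: (idI) => _ ID _; apply: ID => //; apply: idealN. Qed.

Lemma idealD I x y : ideal I -> I x -> I y -> I (x + y).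
Proof. by case=> _ + _; apply. Qed.

Lemma idealMl I a x : ideal I -> I x -> I (a * x).
Proof. by case=> _ _; apply. Qed.

Lemma ideal_sum I (J : Type) (s : seq J) (f : J -> R) :
  ideal I -> (forall j, I (f j)) -> I (\sum_(j <- s) f j).
Proof. by case=> I0 ID _ If; elim/big_ind: _ => // j _; apply: If. Qed.

Lemma ideal_eq I x y : ideal I -> I (x - y) -> I y -> I x.
Proof. by move=> idI Ixy Iy; rewrite -(subrK y x); apply: idealD. Qed.

Lemma prime_ideal (P : prime_idealr R) : ideal (fun x => x \in P).
Proof.
by split=> [|x y Px Py|a x Px]; rewrite ?rpred0 ?rpredD ?idealMr.
Qed.

(** The ideal I + R a. *)
Definition ideal_adj I a x := exists c, I (x - c * a).

Lemma ideal_adjP I a : ideal I -> ideal (ideal_adj I a).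
Proof.
move=> idI; split=> [|x y [c Ic] [d Id]|b x [c Ic]].
- by exists 0; rewrite mul0r subr0; case: idI.
- exists (c + d); rewrite (_ : _ - _ = (x - c * a) + (y - d * a)); last by ring.
  exact: idealD.
- exists (b * c); rewrite (_ : _ - _ = b * (x - c * a)); last by ring.
  exact: idealMl.
Qed.

Lemma ideal_adj_sub I a x : I x -> ideal_adj I a x.
Proof. by move=> Ix; exists 0; rewrite mul0r subr0. Qed.

Lemma ideal_adj_gen I a : ideal I -> ideal_adj I a a.
Proof. by case=> I0 _ _; exists 1; rewrite mul1r subrr. Qed.

Lemma ideal_to_idealr I : ideal I -> ~ I 1 ->
  exists p : idealr R, forall x, (x \in p) <-> I x.
Proof.
move=> [I0 ID IM] I1.
pose P : {pred R} := fun x => `[< I x >].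
have PE x : (x \in P) = `[< I x >] by [].
have cP : idealr_closed P.
  split; rewrite ?PE; [exact/asboolP|exact/asboolPn|].
  move=> a u v; rewrite !PE => /asboolP Iu /asboolP Iv.
  by apply/asboolP/ID => //; apply: IM.
pose mx := isIdealr.Build R P cP.
pose Q : idealr R := HB.pack P mx.
exists Q => x.
by change ((x \in P) <-> I x); rewrite PE; split=> /asboolP.
Qed.

Lemma ideal_to_prime I : ideal I -> ~ I 1 ->
    (forall a b, I (a * b) -> I a \/ I b) ->
  exists p : prime_idealr R, forall x, (x \in p) <-> I x.
Proof.
move=> [I0 ID IM] I1 Ipr.
pose P : {pred R} := fun x => `[< I x >].
have PE x : (x \in P) = `[< I x >] by [].
have cP : idealr_closed P.
  split; rewrite ?PE; [exact/asboolP|exact/asboolPn|].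
  move=> a u v; rewrite !PE => /asboolP Iu /asboolP Iv.
  by apply/asboolP/ID => //; apply: IM.
have pP : prime_idealr_closed P.
  move=> u v; rewrite !PE => /asboolP/Ipr[Iu|Iv]; apply/orP; [left|right];
  exact/asboolP.
pose mx := isIdealr.Build R P cP.
pose mx' := isPrimeIdealrClosed.Build R P pP.
pose Q : prime_idealr R := HB.pack P mx mx'.
exists Q => x.
by change ((x \in P) <-> I x); rewrite PE; split=> /asboolP.
Qed.

(** Stated for predicates because in this form it passes to localizations by contraction, see
    [localization_acc]. *)
Definition acc := forall I : nat -> R -> Prop, (forall k, ideal (I k)) ->
  (forall k x, I k x -> I k.+1 x) -> exists K, forall k x, I k x -> I K x.

Lemma ascending_le (T : Type) (I : nat -> T -> Prop) i j x :
  (forall k x, I k x -> I k.+1 x) -> (i <= j)%N -> I i x -> I j x.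
Proof.
move=> asc /subnK <-; elim: (j - i)%N => // k IH Ix.
by rewrite addSn; apply/asc/IH.
Qed.

(** If no member of [F] above [I0] were maximal, choice would give a strictly ascending chain
    starting at [I0]. *)
Lemma acc_max (F : (R -> Prop) -> Prop) I0 : acc -> (forall I, F I -> ideal I) ->
    F I0 ->
  exists I, [/\ F I, forall x, I0 x -> I x
    & forall J, F J -> (forall x, I x -> J x) -> forall x, J x -> I x].
Proof.
move=> accR Fid FI0; apply: contrapT => nmax.
(* The assumptions on [I] stand under the existential, so that [choice] yields a total function to
   iterate; [hom_neq0_quot] and [ext1_neq0_quot] use the same device. *)
have next I : exists J, F I -> (forall x, I0 x -> I x) ->
    [/\ F J, forall x, I x -> J x & exists2 x, J x & ~ I x].
  have [FI|] := pselect (F I); last by exists I.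
  have [sI|] := pselect (forall x, I0 x -> I x); last by exists I.
  apply: contrapT => nJ; apply: nmax; exists I; split=> // J FJ sIJ x Jx.
  by apply: contrapT => nIx; apply: nJ; exists J => _ _; split=> //; exists x.
have [g gP] := choice next.
pose K k := iter k g I0.
have KP k : F (K k) /\ forall x, I0 x -> K k x.
  elim: k => [|k [FK sK]] //=; have [FgK sg _] := gP _ FK sK.
  by split=> // x /sK/sg.
have [n Kn] := accR K (fun k => Fid _ (KP k).1)
  (fun k => let: And3 _ s _ := gP _ (KP k).1 (KP k).2 in s).
have [_ _ [x]] := gP _ (KP n).1 (KP n).2.
by move=> Kx; apply; apply: (Kn n.+1).
Qed.

Lemma noetherian_acc : noetherian R -> acc.
Proof.
move=> noethR I idI asc.
pose U x := exists k, I k x.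
have [Q QP] : exists Q : submodClosed R^o, forall x, (x \in Q) <-> U x.
  apply: submodule_submodClosed; split=> [|x y [k Ix] [l Iy]|a x [k Ix]].
  - by exists 0%N; case: (idI 0%N).
  - exists (maxn k l); apply: idealD => //.
      exact: ascending_le asc (leq_maxl k l) Ix.
    exact: ascending_le asc (leq_maxr k l) Iy.
  - by exists k; apply: (idealMl _ (idI k)).
have [s sP] := noethR Q.
have [K KP] : exists K, forall i, (i < size s)%N -> I K (submod_val s`_i).
  elim: s {sP} => [|u t [K KP]]; first by exists 0%N.
  have [k Ik] := (QP _).1 (submod_valP u).
  exists (maxn k K) => -[_|i /KP] /=.
    exact: ascending_le asc (leq_maxl k K) Ik.
  exact: ascending_le asc (leq_maxr k K).
exists K => k x Ikx.
have Qx : (x : R^o) \in Q by apply/QP; exists k.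
have [c cE] := sP (Submod Qx).
have -> : x = submod_val (Submod Qx) by [].
rewrite cE submod_val_sum; apply: ideal_sum => // i.
by rewrite submod_valZ; apply: idealMl => //; apply: KP.
Qed.

Lemma sub_maximal I : acc -> ideal I -> ~ I 1 ->
  exists m : prime_idealr R, maximal_ideal m /\ forall x, I x -> x \in m.
Proof.
move=> accR idI I1.
have [J [[idJ J1] sIJ maxJ]] :=
  @acc_max (fun I => ideal I /\ ~ I 1) I accR (fun _ => @proj1 _ _) (conj idI I1).
have Jpr a b : J (a * b) -> J a \/ J b.
  move=> Jab; have [|nJa] := pselect (J a); [by left|right].
  have [[c Jc]|n1] := pselect (ideal_adj J a 1).
    apply: (ideal_eq (y := c * (a * b))) => //; last exact: idealMl.
    by rewrite (_ : _ - _ = b * (1 - c * a)); [apply: idealMl|ring].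
  exfalso; apply: nJa; apply: maxJ (ideal_adj_gen a idJ).
    by split=> //; apply: ideal_adjP.
  by move=> x; apply: ideal_adj_sub.
have [m mP] := ideal_to_prime idJ J1 Jpr.
exists m; split=> [L sL x Lx|x /sIJ/mP //]; apply/mP.
apply: (maxJ (fun x => x \in L)) Lx => [|y /mP/sL //]; split; last by rewrite idealr1.
by split=> [|u v Lu Lv|a u Lu]; rewrite ?rpred0 ?rpredD ?idealMr.
Qed.

Lemma local_unit (m : prime_idealr R) a :
  acc -> is_local m -> a \notin m -> exists b, b * a = 1.
Proof.
move=> accR [_ um] nma; apply: contrapT => na.
pose I x := exists b, x = b * a.
have idI : ideal I.
  split=> [|x y [b ->] [c ->]|c x [b ->]].
  - by exists 0; rewrite mul0r.
  - by exists (b + c); rewrite mulrDl.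
  - by exists (c * b); rewrite mulrA.
have [|n [maxn sn]] := sub_maximal accR idI.
  by move=> [b /esym Eb]; apply: na; exists b.
by case/negP: nma; rewrite -(um n) //; apply: sn; exists 1; rewrite mul1r.
Qed.

End Ideals.

(** * Chains of primes and Ischebeck's theorem *)

Section PrimeChains.
Variable R : comNzRingType.
Implicit Types I : R -> Prop.

(** For an ideal [I] this means dim R/I >= k, expressed without forming R/I. *)
Definition chain_above I k := exists c : nat -> prime_idealr R,
  (forall x, I x -> x \in c 0%N) /\
  forall i, (i < k)%N -> {subset c i <= c i.+1} /\ ~ (c i =i c i.+1).

Lemma chain_above_sub I I' k :
  (forall x, I' x -> I x) -> chain_above I k -> chain_above I' k.
Proof. by move=> sI [c [c0 cS]]; exists c; split=> // x /sI/c0. Qed.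

Lemma chain_above_le I k l : (l <= k)%N -> chain_above I k -> chain_above I l.
Proof.
move=> lk [c [c0 cS]]; exists c; split=> // i il; apply: cS.
exact: leq_trans lk.
Qed.

Lemma chain_above0 (p : prime_idealr R) : chain_above (fun x => x \in p) 0.
Proof. by exists (fun=> p). Qed.

Lemma chain_above_cons (p : prime_idealr R) I k z :
    (forall x, x \in p -> I x) -> I z -> z \notin p -> chain_above I k ->
  chain_above (fun x => x \in p) k.+1.
Proof.
move=> sp Iz nz [c [c0 cS]].
exists (fun i => if i is j.+1 then c j else p); split=> // -[_|i].
  by split=> [x /sp/c0 //|E]; move: nz; rewrite E c0.
exact: cS.
Qed.

End PrimeChains.

(** * Finite generation, submodules of R^s and Nakayama's lemma *)

Section FinitelyGenerated.
Variable R : comNzRingType.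
Implicit Types I J : R -> Prop.
Hypothesis accR : acc R.

Fixpoint ideal_span (s : seq R) : R -> Prop :=
  if s is a :: t then ideal_adj (ideal_span t) a else fun x => x = 0.

Lemma ideal_spanP s : ideal (ideal_span s).
Proof.
elim: s => [|a s IH] /=; last exact: ideal_adjP.
by split=> [//|x y -> ->|b x ->]; rewrite ?addr0 ?mulr0.
Qed.

Lemma ideal_span_sub s J x :
  ideal J -> (forall y, y \in s -> J y) -> ideal_span s x -> J x.
Proof.
move=> idJ; elim: s x => [|a s IH] x /= Js; first by move=> ->; case: idJ.
move=> [c /IH sx]; apply: (ideal_eq (y := c * a)) => //.
  by apply: sx => y ys; apply: Js; rewrite inE ys orbT.
by apply: idealMl => //; apply: Js; rewrite mem_head.
Qed.

(** An ideal maximal among the finitely generated ones inside [I] is [I] itself. *)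
Lemma acc_fg I : ideal I ->
  exists s, (forall y, y \in s -> I y) /\ forall x, I x -> ideal_span s x.
Proof.
move=> idI.
pose F J := exists s, (forall y, y \in s -> I y) /\
                      forall x, J x <-> ideal_span s x.
have Fid J : F J -> ideal J.
  move=> [s [_ Js]]; have [s0 sD sM] := ideal_spanP s.
  by split=> [|x y /Js sx /Js sy|a x /Js sx]; apply/Js; [|apply: sD|apply: sM].
have F0 : F (fun x => x = 0) by exists [::].
have [J [[s [sI Js]] _ maxJ]] := acc_max accR Fid F0.
exists s; split=> // x Ix; apply/Js; apply: (maxJ (ideal_span (x :: s))).
- by exists (x :: s); split=> // y; rewrite inE => /orP[/eqP->|/sI].
- by move=> y /Js; apply: ideal_adj_sub.
- exact/ideal_adj_gen/ideal_spanP.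
Qed.

(* Submodules of R^s, as predicates on functions of which only the first [s]
   values matter. *)
Definition vec_submod s (W : (nat -> R) -> Prop) :=
  [/\ W (fun=> 0), forall v w, W v -> W w -> W (fun i => v i + w i),
      forall a v, W v -> W (fun i => a * v i)
    & forall v w, (forall i, (i < s)%N -> v i = w i) -> W v -> W w].

(** Induction on [s]: a chain in R^(s+1) stabilizes once its images under the last coordinate and
    its intersections with the kernel of that coordinate, a copy of R^s, both do. *)
Lemma acc_vec s (W : nat -> (nat -> R) -> Prop) :
    (forall k, vec_submod s (W k)) -> (forall k v, W k v -> W k.+1 v) ->
  exists K, forall k v, W k v -> W K v.
Proof.
elim: s W => [|s IH] W sW asc.
  by exists 0%N => k v _; case: (sW 0%N) => W0 _ _ We; apply: We W0.
pose I k a := exists v, W k v /\ v s = a.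
have [K1 I1] : exists K, forall k a, I k a -> I K a.
  apply: accR => k; last by move=> a [v [/asc Wv <-]]; exists v.
  have [W0 WD WM _] := sW k; split; first by exists (fun=> 0).
    move=> _ _ [v [Wv <-]] [w [Ww <-]]; exists (fun i => v i + w i).
    by split=> //; apply: WD.
  by move=> a _ [v [Wv <-]]; exists (fun i => a * v i); split=> //; apply: WM.
pose W' k v := exists w, [/\ W k w, w s = 0 & forall i, (i < s)%N -> w i = v i].
have [K2 W2] : exists K, forall k v, W' k v -> W' K v.
  apply: IH => k; last by move=> v [w [/asc Ww ? ?]]; exists w.
  have [W0 WD WM We] := sW k; split.
  - by exists (fun=> 0).
  - move=> v w [v' [Wv v0 Ev]] [w' [Ww w0 Ew]]; exists (fun i => v' i + w' i).
    by split=> [||i /[dup] /Ev -> /Ew ->] //; [apply: WD|rewrite v0 w0 addr0].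
  - move=> a v [v' [Wv v0 Ev]]; exists (fun i => a * v' i).
    by split=> [||i /Ev ->] //; [apply: WM|rewrite v0 mulr0].
  - by move=> v w Evw [v' [Wv v0 Ev]]; exists v'; split=> // i /[dup] /Ev -> /Evw.
have [K12 K21] := (leq_maxl K1 K2, leq_maxr K1 K2).
exists (maxn K1 K2) => k v Wv.
have [_ WD WM We] := sW (maxn K1 K2).
have [u [Wu Eu]] := I1 k (v s) (ex_intro _ v (conj Wv erefl)).
(* [k] may exceed both bounds, so v - u is formed at the later index [m]; its last coordinate is 0,
   which brings it back to [K2]. *)
pose m := maxn k (maxn K1 K2).
have [_ mD mM _] := sW m.
have W'd : W' m (fun i => v i + -1 * u i).
  exists (fun i => v i + -1 * u i); split=> //; last by rewrite Eu; ring.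
  apply: mD; first exact: ascending_le asc (leq_maxl _ _) Wv.
  apply: mM; apply: ascending_le asc _ Wu.
  exact: leq_trans K12 (leq_maxr _ _).
have [w [Ww w0 Ew]] := W2 _ _ W'd.
apply: We (WD _ _ (ascending_le asc K12 Wu) (ascending_le asc K21 Ww)) => i.
by rewrite ltnS leq_eqVlt => /orP[/eqP->|/Ew ->]; rewrite ?w0 ?Eu; ring.
Qed.

(* Nakayama's lemma: [B + sum_k S v_k] stabilizes, so that some [v_(K+1)] lies
   in [B + S v_K], which is contained in [B + z S v_(K+1)]. *)
Lemma nakayama s (B : (nat -> R) -> Prop) z (v : nat -> nat -> R) :
    vec_submod s B -> (forall c, exists t, t * (1 - c * z) = 1) ->
    (forall k, B (fun i => v k i + - z * v k.+1 i)) ->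
  B (v 0%N).
Proof.
move=> sB uz Bv; have [B0 BD BM Be] := sB.
pose W k w := exists c, B (fun i => w i + - c * v k i).
have sW k : vec_submod s (W k).
  split.
  - by exists 0; apply: Be B0 => i _; ring.
  - move=> w w' [c Bw] [c' Bw']; exists (c + c').
    by apply: Be (BD _ _ Bw Bw') => i _; ring.
  - by move=> a w [c Bw]; exists (a * c); apply: Be (BM a _ Bw) => i _; ring.
  - by move=> w w' Ew [c Bw]; exists c; apply: Be Bw => i /Ew ->.
have asc k w : W k w -> W k.+1 w.
  move=> [c Bw]; exists (c * z).
  by apply: Be (BD _ _ Bw (BM c _ (Bv k))) => i _; ring.
have [K WK] := acc_vec sW asc.
have [c Bc] : W K (v K.+1).
  by apply: WK (K.+1) _ _; exists 1; apply: Be B0 => i _; ring.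
have [t tE] := uz c.
have BK : B (v K.+1).
  apply: Be (BM t _ (BD _ _ Bc (BM c _ (Bv K)))) => i _ /=.
  by transitivity (t * (1 - c * z) * v K.+1 i); [ring|rewrite tE mul1r].
(* Membership in [B] descends, as [v k] is [z] times [v k.+1] modulo [B]. *)
elim: {WK Bc} (K.+1) BK => // k IH Bk; apply: IH.
by apply: Be (BD _ _ (Bv k) (BM z _ Bk)) => i _; ring.
Qed.

End FinitelyGenerated.

(** * Hom and Ext^1 between cyclic modules; Ischebeck's theorem over a local ring *)

Section Ext.
Variable R : comNzRingType.
Implicit Types I J Z : R -> Prop.
Hypothesis accR : acc R.

Lemma ideal_lin1 Z a u e : ideal Z -> Z u -> e = a * u -> Z e.
Proof. by move=> idZ Zu ->; apply: idealMl. Qed.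

Lemma ideal_lin2 Z a u b v e :
  ideal Z -> Z u -> Z v -> e = a * u + b * v -> Z e.
Proof. by move=> idZ Zu Zv ->; apply: idealD => //; apply: idealMl. Qed.

Lemma ideal_lin3 Z a u b v c w e : ideal Z -> Z u -> Z v -> Z w ->
  e = a * u + b * v + c * w -> Z e.
Proof.
by move=> idZ Zu Zv Zw ->; do 2?apply: idealD => //; apply: idealMl.
Qed.

(* [f] induces a linear map I -> R / Z *)
Definition hom_mod I Z (f : R -> R) :=
  (forall x y, I x -> I y -> Z (f (x + y) - (f x + f y))) /\
  (forall a x, I x -> Z (f (a * x) - a * f x)).

Definition inner_mod I Z (f : R -> R) := exists n, forall x, I x -> Z (f x - x * n).

(* Ext^1(R / I, R / Z) and Hom(R / I, R / Z) are nonzero *)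
Definition ext1_neq0 I Z := exists f, hom_mod I Z f /\ ~ inner_mod I Z f.
Definition hom_neq0 I Z := exists u, ~ Z u /\ forall x, I x -> Z (x * u).

(** Builds a map on [J] from its graph modulo [Z], for arguments such as x = j + c a that have many
    decompositions and no canonical one. *)
Lemma hom_mod_rel J Z (rel : R -> R -> Prop) : ideal J ->
    (forall x, J x -> exists y, rel x y) ->
    (forall x y y', rel x y -> rel x y' -> Z (y - y')) ->
    (forall x y x' y', rel x y -> rel x' y' -> rel (x + x') (y + y')) ->
    (forall a x y, rel x y -> rel (a * x) (a * y)) ->
  exists h, (forall x, J x -> rel x (h x)) /\ hom_mod J Z h.
Proof.
move=> [_ JD JM] ex uniq relD relM.
have ex' x : exists y, J x -> rel x y.
  by have [/ex[y]|] := pselect (J x); [exists y|exists 0].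
have [h hP] := choice ex'.
exists h; split=> //; split=> [x y Jx Jy|a x Jx].
  by apply: uniq; [apply/hP/JD|apply: relD; apply: hP].
by apply: uniq; [apply/hP/JM|apply/relM/hP].
Qed.

Lemma hom_modB I Z f x y : ideal I -> ideal Z -> hom_mod I Z f ->
  I x -> I y -> Z (f (x - y) - (f x - f y)).
Proof.
move=> idI idZ [fD fM] Ix Iy.
have Zu := fD x (-1 * y) Ix (idealMl _ idI Iy).
have Zv := fM (-1) y Iy.
apply: (ideal_lin2 (a := 1) (b := 1) idZ Zu Zv).
by rewrite (_ : x + -1 * y = x - y); ring.
Qed.

(** Let [J] be maximal among the ideals killing a nonzero [u] of R/Z, and ab in J. If a u = 0, then
    J + R a kills u, so a is in J; otherwise (J : a), which contains b, kills the nonzero a u, so b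
    is in J. *)
Lemma hom_neq0_prime I Z : ideal Z -> ideal I -> hom_neq0 I Z ->
  exists p : prime_idealr R,
    (forall x, I x -> x \in p) /\ hom_neq0 (fun x => x \in p) Z.
Proof.
move=> idZ idI hI.
have [J [[idJ [u [nZu Ju]]] sIJ maxJ]] :=
  @acc_max _ (fun I => ideal I /\ hom_neq0 I Z) I accR (fun _ => @proj1 _ _)
    (conj idI hI).
have J1 : ~ J 1 by move=> /Ju; rewrite mul1r.
have [a b Jab|p pP] := ideal_to_prime idJ J1.
  have [Zau|nZau] := pselect (Z (a * u)).
    left; apply: maxJ (ideal_adj_gen a idJ); last first.
      by move=> x; apply: ideal_adj_sub.
    split; first exact: ideal_adjP.
    exists u; split=> // x [c /Ju Zx].
    by apply: (ideal_lin2 (a := 1) (b := c) idZ Zx Zau); ring.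
  right; apply: (maxJ (fun x => J (x * a))); last by rewrite mulrC.
    split; first split.
    - by rewrite mul0r; case: idJ.
    - by move=> x y Jx Jy; rewrite mulrDl; apply: idealD.
    - by move=> c x Jx; rewrite -mulrA; apply: idealMl.
    - by exists (a * u); split=> // x /Ju; rewrite -mulrA.
  by move=> x Jx; rewrite mulrC; apply: idealMl.
exists p; split=> [x /sIJ/pP //|]; exists u; split=> // x /pP/Ju //.
Qed.

(** For [J] maximal with Ext^1(R/J, R/Z) nonzero and ab in J, the sequence 0 -> R/(J : a) -> R/J ->
    R/(J + R a) -> 0 makes Ext^1 nonzero at an outer term; by maximality the ideal there is [J], so
    [b] or [a] is in [J]. *)
Lemma ext1_neq0_prime I Z : ideal Z -> ideal I -> ext1_neq0 I Z ->
  exists p : prime_idealr R,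
    (forall x, I x -> x \in p) /\ ext1_neq0 (fun x => x \in p) Z.
Proof.
move=> idZ idI eI.
have [J [[idJ [f [homf nf]]] sIJ maxJ]] :=
  @acc_max _ (fun I => ideal I /\ ext1_neq0 I Z) I accR (fun _ => @proj1 _ _)
    (conj idI eI).
have [fD fM] := homf.
have J1 : ~ J 1.
  move=> J1; apply: nf; exists (f 1) => x _.
  by have := fM x 1 J1; rewrite mulr1.
have [a b Jab|p pP] := ideal_to_prime idJ J1; last first.
  exists p; split=> [x /sIJ/pP //|]; exists f; split.
    by split=> [x y /pP Jx /pP Jy|c x /pP Jx]; [apply: fD|apply: fM].
  by move=> [n fn]; apply: nf; exists n => x /pP; apply: fn.
(* The pullback of the class of [f] along multiplication by [a], R/(J : a) -> R/J. *)
have [[n fn]|ng] := pselect (inner_mod (fun x => J (x * a)) Z (fun x => f (x * a))).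
  left; apply: maxJ (ideal_adj_gen a idJ); last first.
    by move=> x; apply: ideal_adj_sub.
  split; first exact: ideal_adjP.
  (* Graph of the extension of [f] to J + R a that sends [a] to [n]; [fn] makes it independent of
     [c]. *)
  pose rel x y := exists c, J (x - c * a) /\ Z (y - (f (x - c * a) + c * n)).
  have [x [c Jx]|x y y' [c [Jx Zy]] [c' [Jx' Zy']]|
        x y x' y' [c [Jx Zy]] [c' [Jx' Zy']]|d x y [c [Jx Zy]]|h [hP homh]] :=
    @hom_mod_rel (ideal_adj J a) Z rel (ideal_adjP a idJ).
  - exists (f (x - c * a) + c * n), c; split=> //.
    by rewrite subrr; case: idZ.
  - have Zd := hom_modB idJ idZ homf Jx' Jx.
    have E : x - c' * a - (x - c * a) = (c - c') * a by ring.
    have Jc : J ((c - c') * a) by rewrite -E; apply: idealB.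
    have := fn _ Jc; rewrite /= -E => Zn.
    have Z1 := idealB idZ Zy Zy'.
    by apply: (ideal_lin3 (a := 1) (b := 1) (c := -1) idZ Z1 Zd Zn); ring.
  - exists (c + c').
    have E : x + x' - (c + c') * a = (x - c * a) + (x' - c' * a) by ring.
    rewrite E; split; first exact: idealD.
    have Zd := fD _ _ Jx Jx'.
    by apply: (ideal_lin3 (a := 1) (b := 1) (c := -1) idZ Zy Zy' Zd); ring.
  - exists (d * c).
    have E : d * x - d * c * a = d * (x - c * a) by ring.
    rewrite E; split; first exact: idealMl.
    by apply: (ideal_lin2 (a := d) (b := -1) idZ Zy (fM d _ Jx)); ring.
  exists h; split=> //; move=> [n' hn']; apply: nf.
  exists n' => x Jx; have Jx' := ideal_adj_sub a Jx.
  have [c [Jc Zc]] := hP _ Jx'.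
  have Jca : J (c * a).
    by rewrite (_ : c * a = x - (x - c * a)); [apply: idealB|ring].
  have /= Zn := fn _ Jca; have Zd := hom_modB idJ idZ homf Jx Jca.
  have Z1 := idealB idZ (hn' _ Jx') Zc.
  by apply: (ideal_lin3 (a := 1) (b := -1) (c := 1) idZ Z1 Zd Zn); ring.
right; apply: (maxJ (fun x => J (x * a))); last by rewrite mulrC.
  split; first split.
  - by rewrite mul0r; case: idJ.
  - by move=> x y Jx Jy; rewrite mulrDl; apply: idealD.
  - by move=> c x Jx; rewrite -mulrA; apply: idealMl.
  - exists (fun x => f (x * a)); split=> //; split=> [x y Jx Jy|c x Jx].
      by rewrite mulrDl; apply: fD.
    by rewrite -mulrA; apply: fM.
by move=> x Jx; rewrite mulrC; apply: idealMl.
Qed.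

Variable m : prime_idealr R.
Hypothesis locR : is_local m.

Lemma local_unit_1B z : z \in m -> forall c, exists t, t * (1 - c * z) = 1.
Proof.
move=> mz c; apply: (local_unit accR locR); apply/negP => mc.
by have := idealr1 m; rewrite -(subrK (c * z) 1) rpredD // idealMr.
Qed.

(* R / Z has a regular sequence of length [n] in [m], properness of the
   quotients not being required. *)
Fixpoint depth_ge n Z : Prop :=
  if n is n'.+1 then exists z,
    [/\ z \in m, forall x, Z (z * x) -> Z x & depth_ge n' (ideal_adj Z z)]
  else True.

(** Hom(R/p, R/Z) consists of the elements of R/Z killed by [p]. If the reduced Hom vanished, each
    of them would be z times another one, as [z] is regular, and Nakayama's lemma would make them
    all zero. *)
Lemma hom_neq0_quot (p : prime_idealr R) Z z : ideal Z -> z \in m ->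
    (forall x, Z (z * x) -> Z x) -> hom_neq0 (fun x => x \in p) Z ->
  z \notin p /\ hom_neq0 (ideal_adj (fun x => x \in p) z) (ideal_adj Z z).
Proof.
move=> idZ mz regz [u [nZu pu]]; split.
  by apply/negP => /pu/regz.
apply: contrapT => nh.
have next w : exists w', (forall x, x \in p -> Z (x * w)) ->
    (forall x, x \in p -> Z (x * w')) /\ Z (w - w' * z).
  have [pw|] := pselect (forall x, x \in p -> Z (x * w)); last by exists 0.
  suff [c Zc] : ideal_adj Z z w.
    exists c => _; split=> // x px; apply: regz.
    by apply: (ideal_lin2 (a := 1) (b := - x) idZ (pw _ px) Zc); ring.
  apply: contrapT => nw; apply: nh; exists w; split=> // x [c /pw Zx].
  by exists (c * w); apply: (ideal_lin1 (a := 1) idZ Zx); ring.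
have [g gP] := choice next.
pose v k := iter k g u.
have vP k : forall x, x \in p -> Z (x * v k).
  by elim: k => // k /gP[].
apply: nZu.
have [Z0 ZD ZM] := idZ.
apply: (@nakayama _ accR 1 (fun w => Z (w 0%N)) z (fun k _ => v k)).
- split=> [//|w w'|a w|w w' E]; [exact: ZD|exact: ZM|by rewrite E].
- exact: local_unit_1B.
- move=> k; have [_ Zk] := gP _ (vP k).
  by apply: (ideal_lin1 (a := 1) idZ Zk); rewrite /v /=; ring.
Qed.

(** If the reduced Ext^1 vanished, every map p -> R/Z would be a multiplication plus z times another
    such map. For Nakayama's lemma a map is represented by its values on finitely many generators of
    [p], and [B] consists of the values of multiplications. *)
Lemma ext1_neq0_quot (p : prime_idealr R) Z z : ideal Z -> z \in m ->
    (forall x, Z (z * x) -> Z x) -> z \notin p ->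
    ext1_neq0 (fun x => x \in p) Z ->
  ext1_neq0 (ideal_adj (fun x => x \in p) z) (ideal_adj Z z).
Proof.
move=> idZ mz regz npz [f0 [homf0 nf0]].
apply: contrapT => ne.
have idp := prime_ideal p.
have idZz := ideal_adjP z idZ.
have next f : exists f', hom_mod (fun x => x \in p) Z f ->
    hom_mod (fun x => x \in p) Z f' /\
    exists n, forall x, x \in p -> Z (f x - x * n - f' x * z).
  have [homf|] := pselect (hom_mod (fun x => x \in p) Z f); last by exists f.
  have [fD fM] := homf.
  (* The map induced by [f] on p + R z modulo Z + R z. It is well defined because z c in p forces c
     in p, and then f(z c) = z f(c) modulo Z. *)
  pose rel x y := exists c, x - c * z \in p /\ ideal_adj Z z (y - f (x - c * z)).
  have [x [c px]|x y y' [c [px Zy]] [c' [px' Zy']]|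
        x y x' y' [c [px Zy]] [c' [px' Zy']]|d x y [c [px Zy]]|h [hP homh]] :=
    @hom_mod_rel (ideal_adj (fun x => x \in p) z) (ideal_adj Z z) rel
      (ideal_adjP z idp).
  - exists (f (x - c * z)), c; split=> //.
    by rewrite subrr; case: idZz.
  - have E : x - c' * z - (x - c * z) = z * (c - c') by ring.
    have pc : z * (c - c') \in p by rewrite -E rpredB.
    move: (pc); rewrite prime_idealrM (negPf npz) /= => pcc.
    have Zd := hom_modB idp idZ homf px' px.
    have Zn := fM z _ pcc.
    rewrite E in Zd.
    have Zz : ideal_adj Z z (f (x - c' * z) - f (x - c * z)).
      exists (f (c - c')).
      by apply: (ideal_lin2 (a := 1) (b := -1) idZ Zn Zd); ring.
    by apply: (ideal_lin3 (a := 1) (b := -1) (c := -1) idZz Zy Zy' Zz); ring.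
  - exists (c + c').
    have E : x + x' - (c + c') * z = (x - c * z) + (x' - c' * z) by ring.
    rewrite E; split; first by rewrite rpredD.
    have Zd := ideal_adj_sub z (fD _ _ px px').
    by apply: (ideal_lin3 (a := 1) (b := 1) (c := -1) idZz Zy Zy' Zd); ring.
  - exists (d * c).
    have E : d * x - d * c * z = d * (x - c * z) by ring.
    rewrite E; split; first by rewrite idealMr.
    have Zd := ideal_adj_sub z (fM d _ px).
    by apply: (ideal_lin2 (a := d) (b := -1) idZz Zy Zd); ring.
  have [n hn] : inner_mod (ideal_adj (fun x => x \in p) z) (ideal_adj Z z) h.
    by apply: contrapT => nh; apply: ne; exists h.
  (* Division of f(x) - x n by [z], unique modulo [Z] as [z] is regular. *)
  pose rel' x y := x \in p /\ Z (f x - x * n - y * z).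
  have [x px|x y y' [px Zy] [_ Zy']|
        x y x' y' [px Zy] [px' Zy']|d x y [px Zy]|f' [f'P homf']] :=
    @hom_mod_rel (fun x => x \in p) Z rel' idp.
  - have px' := @ideal_adj_sub _ (fun x => x \in p) z _ px.
    have [c [pc Zc]] := hP _ px'.
    have pcz : z * c \in p.
      by rewrite (_ : z * c = x - (x - c * z)); [rewrite rpredB|ring].
    move: (pcz); rewrite prime_idealrM (negPf npz) /= => pcc.
    have Zx := hn _ px'.
    have Zd := hom_modB idp idZ homf px pcz.
    have Zn := fM z _ pcc.
    have Zz : ideal_adj Z z (f (x - c * z) - f x).
      exists (- f c); apply: (ideal_lin2 (a := 1) (b := -1) idZ Zd Zn).
      by rewrite (mulrC c z); ring.
    have [y Zy] : ideal_adj Z z (f x - x * n).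
      by apply: (ideal_lin3 (a := 1) (b := -1) (c := -1) idZz Zx Zc Zz); ring.
    by exists y; split.
  - apply: regz.
    by apply: (ideal_lin2 (a := -1) (b := 1) idZ Zy Zy'); ring.
  - split; first by rewrite rpredD.
    by apply: (ideal_lin3 (a := 1) (b := 1) (c := 1) idZ (fD _ _ px px') Zy Zy'); ring.
  - split; first by rewrite idealMr.
    by apply: (ideal_lin2 (a := 1) (b := d) idZ (fM d _ px) Zy); ring.
  by exists f' => _; split=> //; exists n => x /f'P[].
have [g gP] := choice next.
pose F k := iter k g f0.
have homF k : hom_mod (fun x => x \in p) Z (F k).
  by elim: k => // k /gP[].
have [s [sp ps]] := acc_fg accR idp.
have [Z0 ZD ZM] := idZ.
have [|||n Hn] := @nakayama _ accR (size s)
  (fun w => exists n, forall i, (i < size s)%N -> Z (w i - s`_i * n)) z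
  (fun k i => F k s`_i).
- split.
  + by exists 0 => i _; rewrite mulr0 subrr.
  + move=> v w [a va] [b wb]; exists (a + b) => i si.
    by apply: (ideal_lin2 (a := 1) (b := 1) idZ (va i si) (wb i si)); ring.
  + move=> c v [a va]; exists (c * a) => i si.
    by apply: (ideal_lin1 (a := c) idZ (va i si)); ring.
  + by move=> v w E [a va]; exists a => i si; rewrite -E //; apply: va.
- exact: local_unit_1B.
- move=> k; have [_ [n Zn]] := gP _ (homF k).
  exists n => i si; have ps_i := sp _ (mem_nth 0 si).
  by apply: (ideal_lin1 (a := 1) idZ (Zn _ ps_i)); rewrite /F /=; ring.
apply: nf0; exists n => x px.
(* Agreement of [f0] with multiplication by [n] spreads from the generators, as it holds on an
   ideal. *)
pose G y := y \in p /\ Z (f0 y - y * n).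
have idG : ideal G.
  have [fD fM] := homf0.
  split.
  - split; first by rewrite rpred0.
    by have := fM 0 0 (idealr0 _); rewrite !mul0r subr0.
  - move=> a b [pa Za] [pb Zb]; split; first by rewrite rpredD.
    by apply: (ideal_lin3 (a := 1) (b := 1) (c := 1) idZ (fD _ _ pa pb) Za Zb); ring.
  - move=> a b [pb Zb]; split; first by rewrite idealMr.
    by apply: (ideal_lin2 (a := 1) (b := a) idZ (fM a _ pb) Zb); ring.
suff [] : G x by [].
apply: ideal_span_sub (ps x px) => // y /[dup] /sp py ys; split=> //.
by have := Hn (index y s); rewrite index_mem nth_index //; apply.
Qed.

(** The Ext^0 case of Ischebeck's theorem: some prime over p + R z, strictly larger than [p],
    inherits the nonvanishing in depth one less. *)
Lemma hom_neq0_chain n Z (p : prime_idealr R) : ideal Z -> depth_ge n Z ->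
  hom_neq0 (fun x => x \in p) Z -> chain_above (fun x => x \in p) n.
Proof.
elim: n Z p => [|n IH] Z p idZ; first by move=> _ _; apply: chain_above0.
move=> [z [mz regz dz]] hp.
have idZz := ideal_adjP z idZ; have idp := prime_ideal p.
have [npz hz] := hom_neq0_quot idZ mz regz hp.
have [q [sq hq]] := hom_neq0_prime idZz (ideal_adjP z idp) hz.
apply: (chain_above_cons _ (ideal_adj_gen z idp) npz).
  exact: (@ideal_adj_sub _ (fun x => x \in p)).
exact: chain_above_sub sq (IH _ _ idZz dz hq).
Qed.

(* Ischebeck's theorem for Ext^1 *)
Lemma ext1_neq0_chain n Z (p : prime_idealr R) : ideal Z -> depth_ge n Z ->
  ext1_neq0 (fun x => x \in p) Z -> chain_above (fun x => x \in p) n.-1.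
Proof.
elim: n Z p => [|n IH] Z p idZ; first by move=> _ _; apply: chain_above0.
move=> [z [mz regz dz]] ep.
have idZz := ideal_adjP z idZ; have idp := prime_ideal p.
(* If [z] is in [p], then x f(z) = z f(x) puts f(z) in Hom(R/p, R/(Z + R z)); it is nonzero, since
   f(z) = c z modulo Z would give f(x) = x c. One unit of depth is spent on lowering the degree of
   Ext. *)
have [pz|npz] := boolP (z \in p).
  have [f [[fD fM] nf]] := ep.
  apply: (@hom_neq0_chain n (ideal_adj Z z)) => //.
  exists (f z); split=> [[c Zc]|x px].
    apply: nf; exists c => x px; apply: regz.
    have Z1 := fM x _ pz; have Z2 := fM z _ px.
    rewrite (mulrC x z) in Z1.
    by apply: (ideal_lin3 (a := 1) (b := -1) (c := x) idZ Z1 Z2 Zc); ring.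
  exists (f x); have Z1 := fM x _ pz; have Z2 := fM z _ px.
  rewrite (mulrC x z) in Z1.
  by apply: (ideal_lin2 (a := -1) (b := 1) idZ Z1 Z2); ring.
case: n IH dz => [_ _|n IH dz]; first exact: chain_above0.
have ez := ext1_neq0_quot idZ mz regz npz ep.
have [q [sq eq]] := ext1_neq0_prime idZz (ideal_adjP z idp) ez.
apply: (chain_above_cons _ (ideal_adj_gen z idp) npz).
  exact: (@ideal_adj_sub _ (fun x => x \in p)).
exact: chain_above_sub sq (IH _ _ idZz dz eq).
Qed.

Lemma depth_ge_regular_seq (s : seq R) : {subset s <= m} ->
  regular_seq (R^o : lmodType R) s -> depth_ge (size s) (fun x => x = 0).
Proof.
move=> sm [reg _].
pose Zk k := in_seq_mul (V := R^o : lmodType R) (take k s).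
(* [k] counts the elements still to come, so [Z] is generated by the first [size s - k] ones. *)
suff H k Z : (k <= size s)%N -> (forall x, Z x <-> Zk (size s - k)%N x) -> depth_ge k Z.
  apply: H => // x; rewrite subnn /Zk take0; split=> [->|[v ->]]; rewrite ?big_ord0 //.
  by exists (fun=> 0); rewrite big_ord0.
elim: k Z => // k IH Z ks ZE.
have lt : (size s - k.+1 < size s)%N by rewrite ltn_subrL /= (leq_ltn_trans _ ks).
exists s`_(size s - k.+1); split.
- exact/sm/mem_nth.
- by move=> x /ZE Zx; apply/ZE; apply: reg.
apply: IH => [|x]; first exact: ltnW.
have E : take (size s - k) s = rcons (take (size s - k.+1) s) s`_(size s - k.+1).
  by rewrite -take_nth // subnSK.
have Es : size (take (size s - k.+1) s) = (size s - k.+1)%N.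
  by rewrite size_takel // ltnW.
rewrite /Zk E; split=> [[c /ZE[v Ev]]|[v Ev]].
  rewrite Es in Ev.
  exists (fun i => if (i < size s - k.+1)%N then v i else (c : R^o)).
  rewrite size_rcons Es big_ord_recr /= ltnn nth_rcons Es ltnn eqxx.
  rewrite (eq_bigr (fun i : 'I__ => (take (size s - k.+1) s)`_i *: v i)).
    by rewrite -Ev /GRing.scale /=; ring.
  by move=> i _; rewrite nth_rcons Es ltn_ord.
exists (v (size s - k.+1)%N); apply/ZE; exists v.
rewrite Ev size_rcons Es big_ord_recr /= nth_rcons Es ltnn eqxx.
rewrite (eq_bigr (fun i : 'I__ => (take (size s - k.+1) s)`_i *: v i)).
  by rewrite /GRing.scale /=; ring.
by move=> i _; rewrite nth_rcons Es ltn_ord.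
Qed.

End Ext.

(** * Localization *)

Lemma pi_ideal_eq (R : comNzRingType) (I : idealr R) (x y : R) :
  \pi_{ideal_quot I} x = \pi_{ideal_quot I} y <-> x - y \in I.
Proof. by rewrite Quotient.idealrBE; split=> /eqP. Qed.

Lemma pi_ideal_eq0 (R : comNzRingType) (I : idealr R) (x : R) :
  \pi_{ideal_quot I} x = 0 <-> x \in I.
Proof. by rewrite -(rmorph0 (\pi_{ideal_quot I})) pi_ideal_eq subr0. Qed.

(* [psi] exhibits S as the localization of R / P at m / P. *)
Definition quot_localization (R S : comNzRingType) (P m : prime_idealr R)
    (psi : {rmorphism R -> S}) :=
  [/\ forall s, s \notin m -> exists t, psi s * t = 1,
      forall x, exists a s, s \notin m /\ x * psi s = psi a
    & forall a, psi a = 0 <-> a \in P].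

(** Composing R -> R/P with the localization at m/P lets later arguments work with representatives
    in [R]. The kernel is [P] because R/P is a domain and [P] lies in [m]. *)
Lemma cohen_macaulay_quot_localization (R : comNzRingType) (P m : prime_idealr R) :
    maximal_ideal m -> {subset P <= m} -> cohen_macaulay {ideal_quot P} ->
  exists (S : comNzRingType) (psi : {rmorphism R -> S}),
    quot_localization P m psi /\ cohen_macaulay_local S.
Proof.
move=> maxm sPm [_ CM].
pose pi : {rmorphism R -> {ideal_quot P}} := \pi_{ideal_quot P}.
have piK y : pi (repr y) = y by exact: reprK.
pose I y := exists2 a, a \in m & y = pi a.
have IE a : I (pi a) <-> a \in m.
  split=> [[b mb /pi_ideal_eq/sPm mab]|ma]; last by exists a.
  by rewrite -(subrK b a) rpredD.
have [|||n nP] := @ideal_to_prime _ I.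
- split=> [|_ _ [a ma ->] [b mb ->]|x _ [a ma ->]].
  + by exists 0; rewrite ?rpred0 ?rmorph0.
  + by exists (a + b); rewrite ?rpredD ?rmorphD.
  + exists (repr x * a); rewrite ?idealMr // rmorphM.
    by rewrite piK.
- by rewrite -(rmorph1 pi) => /IE; rewrite idealr1.
- move=> x y; rewrite -[x]piK -[y]piK -rmorphM => /IE.
  by rewrite prime_idealrM => /orP[] mx; [left|right]; apply/IE.
have nE a : (pi a \in n) = (a \in m).
  by apply/idP/idP => [/nP/IE|/IE/nP].
have maxn : maximal_ideal n.
  move=> J sJ y Jy.
  have [|J1|L LP] := @ideal_to_idealr _ (fun a => pi a \in J).
  - split=> [|a b Ja Jb|a b Jb]; rewrite ?rmorph0 ?rpred0 //.
      by rewrite rmorphD rpredD.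
    by rewrite rmorphM idealMr.
  - by rewrite rmorph1 idealr1 in J1.
  rewrite -[y]piK nE; apply: (maxm L).
    by move=> a ma; apply/LP/sJ; rewrite nE.
  by apply/LP; rewrite piK.
have [S [phi [[L1 L2 L3] CMS]]] := CM n maxn.
exists S, (phi \o pi : {rmorphism R -> S}); split=> //; split=> /=.
- by move=> s; rewrite -nE => /L1.
- move=> x; have [a [s [ns E]]] := L2 x.
  exists (repr a), (repr s); rewrite -nE.
  by rewrite !piK.
- move=> a; rewrite L3; split=> [[s [ns]]|Pa].
    rewrite -[s]piK -rmorphM => /pi_ideal_eq0; rewrite prime_idealrM.
    by case/orP=> // /sPm; rewrite -nE piK (negPf ns).
  exists 1; rewrite idealr1 mul1r; split=> //; exact/pi_ideal_eq0.
Qed.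

Section Localization.
Variables (R S : comNzRingType) (P m : prime_idealr R) (psi : {rmorphism R -> S}).
Hypotheses (accR : acc R) (sPm : {subset P <= m}).
Hypothesis locS : quot_localization P m psi.

Let psi_unit s : s \notin m -> exists t, psi s * t = 1.
Proof. by case: locS => + _ _; apply. Qed.
Let psi_frac x : exists a s, s \notin m /\ x * psi s = psi a.
Proof. by case: locS => _ + _; apply. Qed.
Let psi_ker a : psi a = 0 <-> a \in P.
Proof. by case: locS. Qed.

Let psi_eq a b : psi a = psi b -> a - b \in P.
Proof. by move=> E; apply/psi_ker; rewrite rmorphB E subrr. Qed.

Let psi_inj_frac x y s : s \notin m -> x * psi s = y * psi s -> x = y.
Proof.
move=> /psi_unit[t st] E.
by rewrite -(mulr1 x) -(mulr1 y) -st !mulrA E.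
Qed.

Let notin_mM s t : s \notin m -> t \notin m -> s * t \notin m.
Proof. by move=> ns nt; rewrite prime_idealrM negb_or ns. Qed.

Lemma localization_ideal I x s : ideal I -> s \notin m -> I (x * psi s) -> I x.
Proof.
move=> idI /psi_unit[t st] Ixs.
by rewrite -(mulr1 x) -st mulrA mulrC; apply: idealMl.
Qed.

Lemma localization_acc : acc S.
Proof.
move=> I idI asc.
have [|k a|K IK] := accR (I := fun k a => I k (psi a)).
- move=> k; split=> [|a b Ia Ib|a b Ib].
  + by rewrite rmorph0; case: (idI k).
  + by rewrite rmorphD; apply: idealD.
  + by rewrite rmorphM; apply: idealMl.
- exact: asc.
exists K => k x Ix; have [a [s [ns E]]] := psi_frac x.
apply: localization_ideal ns _ => //; rewrite E; apply: (IK k).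
by rewrite -E mulrC; apply: idealMl.
Qed.

Lemma prime_extension (p : prime_idealr R) : {subset P <= p} -> {subset p <= m} ->
  exists q : prime_idealr S, forall a, psi a \in q <-> a \in p.
Proof.
move=> sP pm.
pose I x := exists s a, [/\ s \notin m, a \in p & x * psi s = psi a].
have IE a : I (psi a) <-> a \in p.
  split=> [[s [b [ns pb]]]|pa]; last first.
    by exists 1, a; rewrite idealr1 rmorph1 mulr1.
  rewrite -rmorphM => /psi_eq/sP pd.
  have : a * s \in p by rewrite -(subrK b (a * s)) rpredD.
  by rewrite prime_idealrM => /orP[//|/pm]; rewrite (negPf ns).
have idI : ideal I.
  split=> [|x y [s [a [ns pa E]]] [t [b [nt pb F]]]|x y [s [a [ns pa E]]]].
  - by rewrite -(rmorph0 psi); apply/IE; rewrite rpred0.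
  - exists (s * t), (a * t + b * s); split; first exact: notin_mM.
      by rewrite rpredD // mulrC idealMr.
    by rewrite rmorphD !rmorphM -E -F; ring.
  - have [b [t [nt F]]] := psi_frac x.
    exists (t * s), (b * a); split; [exact: notin_mM|exact: idealMr|].
    by rewrite !rmorphM -E -F; ring.
have [||q qP] := ideal_to_prime idI.
- by rewrite -(rmorph1 psi) => /IE; rewrite idealr1.
- move=> x y Ixy.
  have [a [s [ns E]]] := psi_frac x; have [b [t [nt F]]] := psi_frac y.
  have : I (psi (a * b)).
    rewrite rmorphM -E -F (_ : _ * _ = psi s * psi t * (x * y)); last by ring.
    exact: idealMl.
  move/IE; rewrite prime_idealrM => /orP[] /IE; rewrite -?E -?F.
    by left; apply: localization_ideal ns _.
  by right; apply: localization_ideal nt _.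
by exists q => a; rewrite qP IE.
Qed.

Lemma localization_dim n e (c : nat -> prime_idealr R) :
    dim_le (S^o : lmodType S) n -> {subset P <= c 0%N} -> {subset c e <= m} ->
    (forall i, (i < e)%N -> {subset c i <= c i.+1} /\ ~ (c i =i c i.+1)) ->
  (e <= n)%N.
Proof.
move=> dimS sP cm cS.
have mono i j : (i <= j <= e)%N -> {subset c i <= c j}.
  case/andP=> /subnK <-; elim: (j - i)%N => [_ x //|k IH ke x cx].
  by apply: (cS (k + i)%N ke).1; apply: IH => //; apply: ltnW.
have ext i : exists q : prime_idealr S, (i <= e)%N ->
    forall a, psi a \in q <-> a \in c i.
  have [ie|] := leqP i e; last first.
    have [q _] := prime_extension (p := P) (fun x => id) sPm.
    by exists q.
  have [||q qP] := @prime_extension (c i); last by exists q.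
    by move=> x /sP; apply: mono.
  by move=> x /(mono i e); rewrite leqnn ie => /(_ isT)/cm.
have [q qP] := choice ext.
apply: (dimS q); split=> [i _|i ie].
  exists 1 => s; apply: contraNneq => s0.
  by rewrite -(mulr1 s) [s * 1]s0 rpred0.
have [sc nc] := cS i ie.
have qi := qP _ (ltnW ie); have qi1 := qP _ ie.
split=> [x qx|E]; last first.
  by apply: nc => a; apply/idP/idP=> /[dup] + _; rewrite -?qi -?qi1 ?E //;
    move=> /qi1; rewrite -E => /qi.
have [a [s [ns F]]] := psi_frac x.
apply: (localization_ideal (prime_ideal (q i.+1)) ns).
rewrite F; apply/qi1/sc/qi; rewrite -F.
by rewrite mulrC idealMr.
Qed.

Lemma prime_contraction (q : prime_idealr S) :
  exists p : prime_idealr R, forall a, a \in p <-> psi a \in q.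
Proof.
apply: (@ideal_to_prime _ (fun a => psi a \in q)).
- split=> [|a b qa qb|a b qb]; rewrite ?rmorph0 ?rpred0 //.
    by rewrite rmorphD rpredD.
  by rewrite rmorphM idealMr.
- by rewrite rmorph1 idealr1.
- by move=> a b; rewrite rmorphM prime_idealrM => /orP.
Qed.

Lemma contraction_chain (I : S -> Prop) k :
  chain_above I k -> chain_above (fun a => I (psi a)) k.
Proof.
move=> [c [c0 cS]].
have [d dP] := choice (fun i => prime_contraction (c i)).
exists d; split=> [a /c0|i ik]; first by rewrite dP.
have [sc nc] := cS i ik.
split=> [a /dP/sc/dP //|E]; apply: nc => x.
have [a [s [ns F]]] := psi_frac x.
have Ec j : (x \in c j) = (a \in d j).
  apply/idP/idP=> [cx|/dP]; first by apply/dP; rewrite -F mulrC idealMr.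
  by rewrite -F; apply: (localization_ideal (prime_ideal (c j)) ns).
by rewrite !Ec E.
Qed.

Variable (m' : prime_idealr S).
Hypothesis locm' : is_local m'.

(** [f] extends to g : QS -> S. If [g] is multiplication by a/t, then t f is multiplication by [a]
    modulo [P]. Otherwise Ischebeck's theorem gives n - 1 steps above a prime over QS; its
    contraction contains Q and also [z], so n >= e steps start from Q. *)
Lemma localization_inner n e (Q : prime_idealr R) y z f :
    depth_eq m' (S^o : lmodType S) n -> (e <= n)%N ->
    ~ chain_above (fun x => x \in Q) e ->
    y \in Q -> y \notin P -> z \in P -> z \notin Q ->
    hom_mod (fun x => x \in Q) (fun x => x \in P) f ->
  exists2 t, t \notin m &
    inner_mod (fun x => x \in Q) (fun x => x \in P) (fun x => t * f x).
Proof.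
move=> [[s [sm reg szs]] _] en nch Qy nPy Pz nQz [fD fM].
have accS := localization_acc.
have idP := prime_ideal P.
pose J x := exists s q, [/\ s \notin m, q \in Q & x * psi s = psi q].
pose rel x u := exists s q,
  [/\ s \notin m, q \in Q, x * psi s = psi q & u * psi s = psi (f q)].
have idJ : ideal J.
  split=> [|u v [s1 [a [ns pa E]]] [t [b [nt pb F]]]|u v [s1 [a [ns pa E]]]].
  - by exists 1, 0; rewrite idealr1 rpred0 mul0r rmorph0.
  - exists (s1 * t), (a * t + b * s1); split; first exact: notin_mM.
      by rewrite rpredD // mulrC idealMr.
    by rewrite rmorphD !rmorphM -E -F; ring.
  - have [b [t [nt F]]] := psi_frac u.
    exists (t * s1), (b * a); split; [exact: notin_mM|exact: idealMr|].
    by rewrite !rmorphM -E -F; ring.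
(* From y f(x) = x f(y) modulo [P] with [y] outside [P]; hence f(x) modulo [P] depends only on the
   image of x in [S]. *)
have fP x : x \in Q -> x \in P -> f x \in P.
  move=> Qx Px; have : y * f x \in P.
    have Z1 := fM y x Qx; have Z2 := fM x y Qy.
    have Z3 : x * f y \in P by rewrite mulrC idealMr.
    rewrite (mulrC x y) in Z2.
    by apply: (ideal_lin3 (a := -1) (b := 1) (c := 1) idP Z1 Z2 Z3); ring.
  by rewrite prime_idealrM (negPf nPy).
have fM' a x : x \in Q -> psi (f (a * x)) = psi a * psi (f x).
  by move=> /(fM a)/psi_ker; rewrite rmorphB rmorphM => /subr0_eq.
have fD' a x : a \in Q -> x \in Q -> psi (f (a + x)) = psi (f a) + psi (f x).
  move=> Qa Qx; have /psi_ker := fD a x Qa Qx.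
  by rewrite rmorphB rmorphD => /subr0_eq.
have [x [s1 [q [ns Qq E]]]|x u u' [s1 [q [ns Qq E F]]] [t [q' [nt Qq' E' F']]]|
    x u x' u' [s1 [q [ns Qq E F]]] [t [q' [nt Qq' E' F']]]|
    a x u [s1 [q [ns Qq E F]]]|g [gP homg]] :=
  @hom_mod_rel _ J (fun x => x = 0) rel idJ.
- have [t st] := psi_unit ns; exists (psi (f q) * t), s1, q; split=> //.
  by rewrite -mulrA (mulrC t) st mulr1.
- have Pd : t * q - s1 * q' \in P.
    by apply: psi_eq; rewrite !rmorphM -E -E'; ring.
  have Q1 : t * q \in Q by rewrite idealMr.
  have Q2 : s1 * q' \in Q by rewrite idealMr.
  have Qd : t * q - s1 * q' \in Q by rewrite rpredB.
  have /psi_ker := fP _ Qd Pd.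
  have N2 : -1 * (s1 * q') \in Q by rewrite idealMr.
  rewrite (_ : t * q - s1 * q' = t * q + -1 * (s1 * q')); last by ring.
  rewrite fD' // !fM' // -F -F' rmorphN1 => E0.
  apply: (psi_inj_frac (notin_mM ns nt)); rewrite mul0r rmorphM -E0; ring.
- exists (s1 * t), (t * q + s1 * q'); split; first exact: notin_mM.
  + by rewrite rpredD // idealMr.
  + by rewrite rmorphD !rmorphM -E -E'; ring.
  + by rewrite fD' ?idealMr // !fM' // !rmorphM -F -F'; ring.
- have [b [t [nt G]]] := psi_frac a.
  exists (t * s1), (b * q); split; [exact: notin_mM|exact: idealMr| |].
  + by rewrite !rmorphM -E -G; ring.
  + by rewrite fM' // !rmorphM -F -G; ring.
have [[b gb]|ng] := pselect (inner_mod J (fun x => x = 0) g).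
  have [a [t [nt E]]] := psi_frac b.
  exists t => //; exists a => x Qx; apply/psi_ker.
  have Jx : J (psi x) by exists 1, x; rewrite idealr1 rmorph1 mulr1.
  have [s1 [q [ns Qq F G]]] := gP _ Jx.
  have gx : g (psi x) = psi (f x).
    apply: (psi_inj_frac ns); rewrite G mulrC -fM' //.
    have Pd : q - s1 * x \in P by apply: psi_eq; rewrite rmorphM -F mulrC.
    have N1 : s1 * x \in Q by rewrite idealMr.
    have N2 : -1 * (s1 * x) \in Q by rewrite idealMr.
    have Qd : q - s1 * x \in Q by rewrite rpredB.
    have /psi_ker := fP _ Qd Pd.
    rewrite (_ : q - s1 * x = q + -1 * (s1 * x)); last by ring.
    by rewrite fD' // (fM' (-1)) // rmorphN1 mulN1r => /subr0_eq.
  have := gb _ Jx; rewrite gx => /subr0_eq Eb.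
  by rewrite rmorphB !rmorphM Eb -E; ring.
have id0 : ideal (fun x : S => x = 0).
  by split=> [//|? ? -> ->|? ? ->]; rewrite ?addr0 ?mulr0.
have [p [sp ep]] := ext1_neq0_prime accS id0 idJ (ex_intro _ g (conj homg ng)).
have dg := depth_ge_regular_seq sm reg.
have /contraction_chain ch := ext1_neq0_chain accS locm' id0 dg ep.
exfalso; apply: nch; rewrite szs in ch.
apply: (chain_above_le en); case: n en szs ch => [|n] en szs ch.
  exact: chain_above0.
apply: (chain_above_cons _ _ nQz ch) => [x Qx|].
  by apply: sp; exists 1, x; rewrite idealr1 rmorph1 mulr1.
by rewrite (psi_ker z).2 // rpred0.
Qed.

End Localization.

(** * Graded rings *)

Lemma nat_prop_min (P : nat -> Prop) :
  (exists n, P n) -> exists n, P n /\ forall k, P k -> (n <= k)%N.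
Proof.
move=> [n Pn]; have ex : exists n, `[< P n >] by exists n; apply/asboolP.
exists (ex_minn ex); case: ex_minnP => k /asboolP Pk mink; split=> // l Pl.
exact/mink/asboolP.
Qed.

Section ChainTo.
Variable R : comNzRingType.
Implicit Types I : R -> Prop.

(** Bounds the height of r/I from below: unlike in [chain_above], the chain stays inside [r], so it
    survives localization at [r]. *)
Definition chain_to I k (r : prime_idealr R) :=
  exists c : nat -> prime_idealr R, [/\ forall x, I x -> x \in c 0%N,
    forall i, (i < k)%N -> {subset c i <= c i.+1} /\ ~ (c i =i c i.+1)
    & {subset c k <= r}].

Lemma chain_to0 I (r : prime_idealr R) :
  (forall x, I x -> x \in r) -> chain_to I 0 r.
Proof. by move=> Ir; exists (fun=> r); split. Qed.

Lemma chain_to_rcons I k (r r' : prime_idealr R) z :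
    chain_to I k r -> {subset r <= r'} -> z \in r' -> z \notin r ->
  chain_to I k.+1 r'.
Proof.
move=> [c [c0 cS ck]] srr' zr' zr.
exists (fun i => if (i <= k)%N then c i else r'); split=> //; last by rewrite ltnn.
move=> i; rewrite ltnS => ik; rewrite ik ltn_neqAle ik andbT.
have [->|nik] := eqVneq i k; last by apply: cS; rewrite ltn_neqAle nik.
split=> [x /ck/srr' //|E]; case/negP: zr; apply: ck.
by rewrite E.
Qed.

End ChainTo.

Section Graded.
Variables (R : comNzRingType) (G : nat -> zmodClosed R).

(* An element of R is identified with the polynomial whose i-th coefficient is
   its component of degree i. *)
Lemma direct_sum_poly : direct_sum G ->
  exists th : R -> {poly R}, [/\ forall x i, (th x)`_i \in G i,
    forall x, (th x).[1] = x
    & forall p : {poly R}, (forall i, p`_i \in G i) -> th p.[1] = p].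
Proof.
move=> [ex uniqG].
have ex' x : exists p : {poly R}, (forall i, p`_i \in G i) /\ p.[1] = x.
  have [s [f [fG ->]]] := ex x.
  exists (\sum_(i <- s) f i *: 'X^i); split=> [j|]; last first.
    rewrite horner_sum; apply: eq_bigr => i _.
    by rewrite hornerZ hornerXn expr1n mulr1.
  rewrite coef_sum rpred_sum // => i _; rewrite coefZ coefXn.
  by have [->|_] := eqVneq j i; rewrite ?mulr1 ?mulr0 ?rpred0.
have [th thP] := choice ex'.
exists th; split=> [x i|x|p pG]; [exact: (thP x).1|exact: (thP x).2|].
have [qG qE] := thP p.[1]; move: (th _) qG qE => q qG qE.
have rG i : (q - p)`_i \in G i by rewrite coefB rpredB.
have r0 : (q - p).[1] = 0 by rewrite hornerD hornerN qE subrr.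
apply/eqP; rewrite -subr_eq0; apply/eqP/polyP => i; rewrite coef0.
have [si|si] := ltnP i (size (q - p)); last by rewrite nth_default.
apply: (uniqG (iota 0 (size (q - p))) (fun i => (q - p)`_i)) => //.
- exact: iota_uniq.
- rewrite -[RHS]r0 horner_coef.
  rewrite -(big_mkord xpredT (fun i => (q - p)`_i * 1 ^+ i)) /index_iota subn0.
  by apply: eq_bigr => j _; rewrite expr1n mulr1.
- by rewrite mem_iota.
Qed.

Variable th : R -> {poly R}.
Hypotheses (G1 : 1 \in G 0%N)
  (GM : forall i j x y, x \in G i -> y \in G j -> x * y \in G (i + j)%N)
  (thG : forall x i, (th x)`_i \in G i) (thE : forall x, (th x).[1] = x)
  (thU : forall p : {poly R}, (forall i, p`_i \in G i) -> th p.[1] = p).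

Lemma comp_hom a k : a \in G k -> th a = a *: 'X^k.
Proof.
move=> Ga; rewrite -[in LHS](_ : (a *: 'X^k).[1] = a); last first.
  by rewrite hornerZ hornerXn expr1n mulr1.
apply: thU => i; rewrite coefZ coefXn.
by have [->|_] := eqVneq i k; rewrite ?mulr1 ?mulr0 ?rpred0.
Qed.

Lemma compB x y : th (x - y) = th x - th y.
Proof.
rewrite -[in LHS](thE x) -[in LHS](thE y) -hornerN -hornerD; apply: thU => i.
by rewrite coefB rpredB.
Qed.

Lemma compD x y : th (x + y) = th x + th y.
Proof.
rewrite -[in LHS](thE x) -[in LHS](thE y) -hornerD; apply: thU => i.
by rewrite coefD rpredD.
Qed.

Lemma compM x y : th (x * y) = th x * th y.
Proof.
rewrite -[in LHS](thE x) -[in LHS](thE y) -hornerM; apply: thU => i.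
rewrite coefM rpred_sum // => j _.
by rewrite -[X in G X](subnKC (leq_ord j)); apply: GM.
Qed.

Lemma comp0 : th 0 = 0.
Proof. by rewrite (comp_hom (k := 0)) ?rpred0 // scale0r. Qed.

Lemma coef_homM a k x n : a \in G k ->
  (th (a * x))`_n = if (n < k)%N then 0 else a * (th x)`_(n - k).
Proof.
move=> Ga; rewrite compM (comp_hom Ga) -scalerAl coefZ coefXnM.
by case: ifP; rewrite ?mulr0.
Qed.

Lemma coef_hom a k n : a \in G k -> (th a)`_n = if n == k then a else 0.
Proof.
move=> Ga; rewrite (comp_hom Ga) coefZ coefXn.
by case: eqP; rewrite ?mulr1 ?mulr0.
Qed.

Lemma sum_comp x n : (forall i, (n <= i)%N -> (th x)`_i = 0) ->
  x = \sum_(i < n) (th x)`_i.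
Proof.
move=> x0; rewrite -[LHS]thE (@horner_coef_wide _ n).
  by apply: eq_bigr => i _; rewrite expr1n mulr1.
exact/leq_sizeP.
Qed.

Definition graded_ideal (I : R -> Prop) := forall x i, I x -> I (th x)`_i.

Lemma ideal_of_comp I x : ideal I -> (forall i, I (th x)`_i) -> I x.
Proof.
move=> idI Ix; rewrite (@sum_comp x (size (th x))).
  exact: ideal_sum.
by move=> i si; rewrite nth_default.
Qed.

(* The graded core p*, the largest graded ideal in p *)
Lemma graded_core (p : prime_idealr R) :
  exists c : prime_idealr R, forall x, (x \in c) <-> forall i, (th x)`_i \in p.
Proof.
apply: (@ideal_to_prime _ (fun x => forall i, (th x)`_i \in p)).
- split=> [i|x y px py i|a x px i]; first by rewrite comp0 coef0 rpred0.
    by rewrite compD coefD rpredD.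
  by rewrite compM coefM rpred_sum // => j _; rewrite idealMr.
- move=> /(_ 0%N); rewrite (comp_hom G1) coefZ coefXn mulr1.
  by rewrite idealr1.
move=> x y pxy; apply: contrapT => /not_orP[/existsNP ex /existsNP ey].
(* With x_i and y_j the components of least degree outside [p], the component of xy in degree i + j
   is x_i y_j modulo [p]. *)
have [i [/negP npi mini]] := nat_prop_min ex.
have [j [/negP npj minj]] := nat_prop_min ey.
have ltj k : (k < j)%N -> (th y)`_k \in p.
  by move=> kj; apply: contrapT => /minj; rewrite leqNgt kj.
have lti k : (k < i)%N -> (th x)`_k \in p.
  by move=> ki; apply: contrapT => /mini; rewrite leqNgt ki.
have := pxy (i + j)%N.
have ij : (i < (i + j).+1)%N by rewrite ltnS leq_addr.
rewrite compM coefM (bigD1 (Ordinal ij)) //= addKn => pS.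
have : (th x)`_i * (th y)`_j \in p.
  rewrite -(addrK (\sum_(k < (i + j).+1 | k != Ordinal ij)
    (th x)`_k * (th y)`_(i + j - k)) (_ * _)).
  rewrite rpredB // rpred_sum // => k.
  rewrite -val_eqE /= => nki; have [ki|ik] := ltnP k i.
    by rewrite mulrC idealMr // lti.
  by rewrite idealMr // ltj //; have := ltn_ord k; lia.
by rewrite prime_idealrM (negPf npi) (negPf npj).
Qed.

Lemma graded_core_comp (p c : prime_idealr R) x i :
    (forall x, (x \in c) <-> forall i, (th x)`_i \in p) ->
  x \in c -> (th x)`_i \in c.
Proof.
move=> cE /cE px; apply/cE => j; rewrite (coef_hom _ (thG x i)).
by case: eqP => // _; rewrite rpred0.
Qed.

Lemma graded_core_sub (p c : prime_idealr R) :
  (forall x, (x \in c) <-> forall i, (th x)`_i \in p) -> {subset c <= p}.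
Proof.
by move=> cE x /cE; apply: (@ideal_of_comp (fun x => x \in p)); apply: prime_ideal.
Qed.

(** * Nested primes with the same graded core *)

Section SameCore.
Variables (q p c : prime_idealr R).
Hypothesis sqp : {subset q <= p}.
Hypothesis cp : forall x, (x \in c) <-> forall i, (th x)`_i \in p.
Hypothesis cq : forall x, (x \in c) <-> forall i, (th x)`_i \in q.

(** Modulo [c] the components of [g] occupy at most [l] degrees, from [j] on; [l] serves as
    Euclidean size. *)
Let window g j l := forall n, (th g)`_n \notin c -> (j <= n < j + l)%N.

Let scq : {subset c <= q}. Proof. exact: graded_core_sub cq. Qed.
Let scp : {subset c <= p}. Proof. exact: graded_core_sub cp. Qed.

Let mem_core x : (forall i, (th x)`_i \in c) -> x \in c.
Proof. by apply: (@ideal_of_comp (fun x => x \in c)); apply: prime_ideal. Qed.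

Let hom_mem_core (r : prime_idealr R) a k :
  (forall x, (x \in c) <-> forall i, (th x)`_i \in r) ->
  a \in G k -> a \in r -> a \in c.
Proof.
move=> cr Ga ra; apply/cr => i; rewrite (coef_hom _ Ga).
by case: eqP => // _; rewrite rpred0.
Qed.

(* The homogeneous localization of R / c is a ring k[t, 1/t]; pseudo-division by
   an element [g] of least spread of degrees replaces its Euclidean division. *)
Let pseudo_division g j l :
    (forall f i k, f \in p -> window f i k -> (k < l)%N -> f \in c) ->
    g \in p -> window g j l -> (0 < l)%N -> (th g)`_(j + l.-1) \notin c ->
    forall k f i, f \in p -> window f i k ->
  exists e s h, [/\ s \in G e, s \notin c, s * f - h * g \in c
    & forall n, (th h)`_n \notin c ->
        (i + e <= n + j)%N /\ (n + j + l <= i + e + k)%N].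
Proof.
move=> minl pg wg l0 nb; elim=> [|k IH] f i pf wf.
  exists 0%N, 1, 0; split=> //; first by rewrite idealr1.
    by rewrite mul1r mul0r subr0; apply: (minl _ _ _ pf wf).
  by move=> n; rewrite comp0 coef0 rpred0.
have [kl|lk] := ltnP k.+1 l.
  exists 0%N, 1, 0; split=> //; first by rewrite idealr1.
    by rewrite mul1r mul0r subr0; apply: (minl _ _ _ pf wf).
  by move=> n; rewrite comp0 coef0 rpred0.
set b := (th g)`_(j + l.-1) in nb.
pose a := (th f)`_(i + k).
have Gb : b \in G (j + l.-1)%N by apply: thG.
have Ga : a \in G (i + k)%N by apply: thG.
(* Cross-multiplication cancels the top components [a] of [f] and [b] of [g]; the factor [b] shifts
   the window by its degree. *)
have pf' : b * f - a * g \in p by rewrite rpredB // idealMr.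
have wf' : window (b * f - a * g) (i + j + l.-1) k.
  move=> n; apply: contraNT => nn.
  have cf u : ~~ (i <= u < i + k.+1)%N -> (th f)`_u \in c.
    by apply: contraNT => /wf.
  have cg u : ~~ (j <= u < j + l)%N -> (th g)`_u \in c.
    by apply: contraNT => /wg.
  rewrite compB coefB (coef_homM _ _ Gb) (coef_homM _ _ Ga).
  have [->|nen] := eqVneq n (i + j + l.-1 + k)%N.
    rewrite !ifN; [|clear -lk l0; lia..].
    rewrite (_ : i + j + l.-1 + k - (j + l.-1) = i + k)%N; last by lia.
    rewrite (_ : i + j + l.-1 + k - (i + k) = j + l.-1)%N; last by lia.
    by rewrite -/a -/b mulrC subrr rpred0.
  rewrite rpredB //; case: ifP => ?; rewrite ?rpred0 // idealMr //.
    by apply: cf; lia.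
  by apply: cg; lia.
have [e [s [h [Gs ncs cd wh]]]] := IH _ _ pf' wf'.
have Gsb := GM Gs Gb; have Gsa := GM Gs Ga.
exists (e + (j + l.-1))%N, (s * b), (s * a + h); split=> //.
- by rewrite prime_idealrM negb_or ncs.
- by rewrite (_ : _ - _ = s * (b * f - a * g) - h * g) //; ring.
move=> n; rewrite compD coefD (coef_hom _ Gsa).
have [-> _|_] := eqVneq n (e + (i + k))%N.
  by clear -lk l0; lia.
by rewrite add0r => /wh; clear -lk l0; lia.
Qed.

(** In k[t, 1/t] a nonzero prime is maximal. Concretely, let [g] have least window in p outside c.
    It is not in q, since pseudo-division of [z] by it would put s z in q. Dividing by [g] an
    element of least window in q outside c then leaves a quotient in q, outside c, with a shorter
    window. *)
Lemma graded_core_neq z f : z \in p -> z \notin q -> f \in q -> f \notin c -> False.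
Proof.
move=> pz nqz qf ncf.
have win x : window x 0 (size (th x)).
  move=> n; apply: contraNT; rewrite -leqNgt => sn.
  by rewrite nth_default ?rpred0.
have [l [[g [j [pg ncg wg]]] minl]] := @nat_prop_min
    (fun l => exists g j, [/\ g \in p, g \notin c & window g j l])
  (ex_intro _ _ (ex_intro _ f (ex_intro _ 0%N (And3 (sqp qf) ncf (win f))))).
have [k [[f' [i [qf' ncf' wf']]] mink]] := @nat_prop_min
    (fun l => exists g j, [/\ g \in q, g \notin c & window g j l])
  (ex_intro _ _ (ex_intro _ f (ex_intro _ 0%N (And3 qf ncf (win f))))).
have minl' x u v : x \in p -> window x u v -> (v < l)%N -> x \in c.
  move=> px wx vl; apply: contrapT => /negP ncx.
  by have := minl v (ex_intro _ x (ex_intro _ u (And3 px ncx wx))); rewrite leqNgt vl.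
have l0 : (0 < l)%N.
  rewrite lt0n; apply: contra ncg => /eqP l0; apply: mem_core => n.
  by apply: contrapT => /negP/wg; rewrite l0; clear; lia.
have nb : (th g)`_(j + l.-1) \notin c.
  apply: contra ncg => cb; apply: (minl' g j l.-1) => //; last by rewrite prednK.
  move=> n nc; have := wg _ nc.
  have [E|] := eqVneq n (j + l.-1)%N; last by clear -l0; lia.
  by rewrite E cb in nc.
(* A window of one degree makes [g] homogeneous modulo [c], but homogeneous elements of [p] lie in
   [c]. This is what makes the quotient's window k - l + 1 shorter than k. *)
have l1 : (1 < l)%N.
  rewrite ltn_neqAle l0 andbT; apply: contra ncg => /eqP l1.
  have cgb : g - (th g)`_j \in c.
    apply: mem_core => n; rewrite compB coefB (coef_hom _ (thG g j)).
    have [->|nj] := eqVneq n j; first by rewrite subrr rpred0.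
    by rewrite subr0; apply: contraNT nj => /wg; clear -l1; lia.
  have pgj : (th g)`_j \in p.
    by rewrite -(subKr g (th g)`_j) rpredB // scp.
  by rewrite -(subrK (th g)`_j g) rpredD // (hom_mem_core cp (thG g j)).
have nqs s e : s \in G e -> s \notin c -> s \notin q.
  by move=> Gs; apply: contra; apply: (hom_mem_core cq Gs).
have lk : (l <= k)%N.
  by rewrite leqNgt; apply: contra ncf' => /(minl' _ _ _ (sqp qf') wf').
have nqg : g \notin q.
  apply/negP => qg.
  have [e [s [h [Gs ncs cd _]]]] := pseudo_division minl' pg wg l0 nb pz (win z).
  have : s * z \in q.
    by rewrite -(subrK (h * g) (s * z)) rpredD ?idealMr // scq.
  by rewrite prime_idealrM (negPf nqz) (negPf (nqs _ _ Gs ncs)).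
have [e [s [h [Gs ncs cd wh]]]] :=
  pseudo_division minl' pg wg l0 nb (sqp qf') wf'.
have qh : h \in q.
  have : h * g \in q.
    by rewrite -(subKr (s * f') (h * g)) rpredB ?idealMr // scq.
  by rewrite prime_idealrM (negPf nqg) orbF.
have nch : h \notin c.
  apply/negP => ch; have : s * f' \in c.
    by rewrite -(subrK (h * g) (s * f')) rpredD // mulrC idealMr.
  by rewrite prime_idealrM (negPf ncs) (negPf ncf').
have wh' : window h (i + e - j) (k - l + 1).
  by move=> n /wh; clear -lk l0; lia.
by have := mink _ (ex_intro _ h (ex_intro _ _ (And3 qh nch wh'))); clear -lk l1; lia.
Qed.

End SameCore.

(* ht p <= ht p* + 1, relative to P *)
Lemma chain_to_graded_core (P : prime_idealr R) k (c : nat -> prime_idealr R)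
    (r : prime_idealr R) :
    graded_ideal (fun x => x \in P) -> {subset P <= c 0%N} ->
    (forall i, (i < k)%N -> {subset c i <= c i.+1} /\ ~ (c i =i c i.+1)) ->
    (forall x, (x \in r) <-> forall i, (th x)`_i \in c k) ->
    (exists2 x, x \in c k & x \notin r) ->
  chain_to (fun x => x \in P) k.-1 r.
Proof.
move=> grP sP; elim: k r => [|k IH] r cS rE [f cf nrf].
  by apply: chain_to0 => x Px; apply/rE => i; apply/sP/grP.
have mono i : (i <= k.+1)%N -> {subset P <= c i}.
  elim: i => [//|i IHi] ik x /(IHi (ltnW ik)); exact: (cS i ik).1.
have [sk nk] := cS k (ltnSn k).
have cS' i : (i < k)%N -> {subset c i <= c i.+1} /\ ~ (c i =i c i.+1).
  by move=> ik; apply: cS; apply: ltnW.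
have [r' r'E] := graded_core (c k).
have sr : {subset r' <= r} by move=> x /r'E rx; apply/rE => i; apply/sk/rx.
(* If [c k] equals its core, it lies in [r], and dropping the last prime is enough. *)
have [ex|nex] := pselect (exists2 x, x \in c k & x \notin r'); last first.
  exists c; split=> // x cx; apply: sr; apply: contrapT => /negP nx.
  by apply: nex; exists x.
case: k => [|k] in IH cS rE cf mono sk nk cS' r'E ex *.
  by apply: chain_to0 => x Px; apply/rE => i; apply/(mono 1%N)/grP.
have := IH r' cS' r'E ex.
(* The cores differ: otherwise [c k.+1] would lie strictly between the common core and [c k.+2]. *)
have [z rz nr'z] : exists2 z, z \in r & z \notin r'.
  apply: contrapT => nz.
  have rr' x : (x \in r') = (x \in r).
    apply/idP/idP=> [/sr //|rx]; apply: contrapT => /negP nx.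
    by apply: nz; exists x.
  have [z cz ncz] : exists2 z, z \in c k.+2 & z \notin c k.+1.
    by apply: not_subsetP => nsk; apply: nk => x; apply/idP/idP=> [/sk|/nsk].
  have [g cg nrg] := ex.
  apply: (@graded_core_neq _ _ r' sk _ r'E z g) => // x.
  by rewrite rr' rE.
by move=> ch; apply: (chain_to_rcons ch sr rz nr'z).
Qed.

Variable m : prime_idealr R.
Hypothesis m_irr : forall x, (th x)`_0 = 0 -> x \in m.
Hypothesis G0_unit : forall x, x \in G 0%N -> x != 0 -> exists y, y * x = 1.

Lemma graded_sub_irrelevant (p : prime_idealr R) :
  graded_ideal (fun x => x \in p) -> {subset p <= m}.
Proof.
move=> grp x px; apply: m_irr; apply/eqP; apply: contraTT isT => x0.
have [y yx] := G0_unit (thG x 0) x0.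
by have := idealr1 p; rewrite -yx idealMr //; apply: grp.
Qed.

Lemma irrelevant_maximal : maximal_ideal m.
Proof.
move=> I smI x Ix; apply: m_irr; apply/eqP; apply: contraTT isT => x0.
have [y yx] := G0_unit (thG x 0) x0.
have mx : x - (th x)`_0 \in m.
  by apply: m_irr; rewrite compB coefB (coef_hom _ (thG x 0)) subrr.
have := idealr1 I; rewrite -yx idealMr //.
by rewrite -(subKr x (th x)`_0) rpredB // smI.
Qed.

(** The step lost in [chain_to_graded_core] is regained at the end: if the last prime is not graded,
    its core is strictly smaller than [m], which can be appended. *)
Lemma graded_chain_to (P : prime_idealr R) e :
    graded_ideal (fun x => x \in P) -> chain_above (fun x => x \in P) e ->
  chain_to (fun x => x \in P) e m.
Proof.
move=> grP [c [sP cS]].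
have [r rE] := graded_core (c e).
have grr : graded_ideal (fun x => x \in r) by move=> x i; apply: graded_core_comp.
have srm := graded_sub_irrelevant grr.
have src : {subset r <= c e} := graded_core_sub rE.
have [[f cf nrf]|nex] := pselect (exists2 x, x \in c e & x \notin r); last first.
  exists c; split=> // x cx; apply: srm; apply: contrapT => /negP nx.
  by apply: nex; exists x.
have ch := chain_to_graded_core grP sP cS rE (ex_intro2 _ _ f cf nrf).
case: e => [|e] in cS rE cf src ch *.
  by apply: chain_to0; apply: graded_sub_irrelevant.
have [z mz nrz] : exists2 z, z \in m & z \notin r.
  apply: contrapT => nz.
  have smr : {subset m <= r}.
    move=> x mx; apply: contrapT => /negP nx.
    by apply: nz; exists x.
  by case/negP: nrf; apply/smr/(irrelevant_maximal (I := c e.+1)) => // x /smr/src.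
exact: chain_to_rcons ch srm mz nrz.
Qed.

(** The degree 0 component of [t] is a unit, so the components of [b] fall into [I] one degree after
    the other. *)
Lemma graded_mul_mem I t b : ideal I -> graded_ideal I -> t \notin m ->
  I (t * b) -> I b.
Proof.
move=> idI grI nt Itb; apply: ideal_of_comp => // i.
have [|y yt] := G0_unit (thG t 0).
  by apply: contraNneq nt => /m_irr.
elim/ltn_ind: i => i IH; have := grI _ i Itb.
rewrite compM coefM big_ord_recl /= subn0 => IS.
rewrite -[_`_i]mul1r -yt -mulrA; apply: idealMl => //.
rewrite -(addrK (\sum_(j < i) (th t)`_(bump 0 j) * (th b)`_(i - bump 0 j)) (_ * _)).
apply: idealB => //; apply: ideal_sum => // j.
by apply: idealMl => //; apply: IH; rewrite /bump /=; have := ltn_ord j; lia.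
Qed.

(** Clears the denominator [t]. For a homogeneous [q] in Q outside P, the graded ideal P + R q
    contains t f(q), hence f(q). If f(q) = a q modulo P, then q (f(x) - x a) is in P for all x in Q,
    and [q] cancels. *)
Lemma graded_inner (P Q : prime_idealr R) y t f :
    graded_ideal (fun x => x \in P) -> graded_ideal (fun x => x \in Q) ->
    y \in Q -> y \notin P -> t \notin m ->
    hom_mod (fun x => x \in Q) (fun x => x \in P) f ->
    inner_mod (fun x => x \in Q) (fun x => x \in P) (fun x => t * f x) ->
  inner_mod (fun x => x \in Q) (fun x => x \in P) f.
Proof.
move=> grP grQ Qy nPy nmt [_ fM] [n fn].
have idP := prime_ideal P.
have [i nPi] : exists i, (th y)`_i \notin P.
  apply: contrapT => nex; case/negP: nPy.
  apply: (@ideal_of_comp (fun x => x \in P)) => // i.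
  by apply: contrapT => /negP nP; apply: nex; exists i.
set q := (th y)`_i in nPi; have Gq : q \in G i by apply: thG.
have Qq : q \in Q by apply: grQ.
have nPt : t \notin P by apply: contra nmt; apply: graded_sub_irrelevant.
have grPq : graded_ideal (ideal_adj (fun x => x \in P) q).
  move=> x j [c /(grP _ j)]; rewrite compB coefB mulrC (coef_homM _ _ Gq).
  case: ifP => _ Px; first by exists 0; rewrite mul0r.
  by exists (th c)`_(j - i); rewrite mulrC.
have [a Pa] : ideal_adj (fun x => x \in P) q (f q).
  apply: (graded_mul_mem (ideal_adjP q idP) grPq nmt).
  by exists n; rewrite (mulrC n); apply: fn.
exists a => x Qx.
have : q * (f x - x * a) \in P.
  have Z1 := fM q x Qx; have Z2 := fM x q Qq; rewrite (mulrC x q) in Z2.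
  by apply: (ideal_lin3 (a := -1) (b := 1) (c := x) idP Z1 Z2 Pa); ring.
by rewrite prime_idealrM (negPf nPi).
Qed.

End Graded.

(** * Graded modules *)

Section GradedModule.
Variables (R : comNzRingType) (V : lmodType R).
Variables (G : nat -> zmodClosed R) (H : int -> zmodClosed V).
Hypotheses (dsH : direct_sum H)
  (GH : forall i j a x, a \in G i -> x \in H j -> a *: x \in H (i%:Z + j)).

Definition in_degrees lo r x := exists f : nat -> V,
  (forall j : nat, f j \in H (lo + j%:Z)) /\ x = \sum_(j < r) f j.

Lemma in_degreesD lo r x y :
  in_degrees lo r x -> in_degrees lo r y -> in_degrees lo r (x + y).
Proof.
move=> [f [fH ->]] [g [gH ->]]; exists (fun j => f j + g j); split=> [j|].
  by rewrite rpredD.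
by rewrite big_split.
Qed.

Lemma in_degreesN lo r x : in_degrees lo r x -> in_degrees lo r (- x).
Proof.
move=> [f [fH ->]]; exists (fun j => - f j); split=> [j|].
  by rewrite rpredN.
by rewrite sumrN.
Qed.

Lemma in_degrees_hom lo (r j : nat) x :
  (j < r)%N -> x \in H (lo + j%:Z) -> in_degrees lo r x.
Proof.
move=> jr Hx; exists (fun i => if i == j then x else 0); split=> [i|].
  by case: eqP => [->|_]; rewrite ?rpred0.
rewrite (bigD1 (Ordinal jr)) //= eqxx big1 ?addr0 // => i.
by rewrite -val_eqE /= => /negPf ->.
Qed.

Lemma in_degrees0 lo r : in_degrees lo r 0.
Proof. by exists (fun=> 0); split=> [j|]; rewrite ?rpred0 // big1. Qed.

Lemma in_degrees_sum lo r (I : Type) (s : seq I) (P : pred I) (f : I -> V) :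
  (forall i, P i -> in_degrees lo r (f i)) ->
  in_degrees lo r (\sum_(i <- s | P i) f i).
Proof.
move=> fI; elim/big_ind: _ => //; [exact: in_degrees0|exact: in_degreesD].
Qed.

Lemma in_degrees_uniq lo (r : nat) x :
  in_degrees lo r x -> x \in H (lo + r%:Z) -> x = 0.
Proof.
move=> [f [fH xE]] Hx.
pose g (i : int) : V := if i == lo + r%:Z then - x
  else if 0 <= i - lo then f `|i - lo|%N else 0.
have gH i : g i \in H i.
  rewrite /g; case: eqP => [->|_]; first by rewrite rpredN.
  case: ifP => [i0|_]; last by rewrite rpred0.
  have iE : lo + `|i - lo|%N%:Z = i by clear -i0; lia.
  by rewrite -[X in H X]iE; apply: fH.
have ul : uniq [seq lo + j%:Z | j <- iota 0 r.+1].
  by rewrite map_inj_uniq ?iota_uniq // => i j /addrI [].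
have := dsH.2 _ g ul gH.
rewrite big_map -addn1 iotaD big_cat /= add0n big_seq1 {2}/g eqxx.
rewrite (eq_big_seq f); last first.
  move=> j; rewrite mem_iota add0n => /= jr; rewrite /g.
  have -> : (lo + j%:Z == lo + r%:Z) = false.
    by apply/negP => /eqP/addrI []; lia.
  by rewrite addrAC subrr add0r.
have -> : \sum_(j <- iota 0 r) f j = x.
  by rewrite xE -(big_mkord xpredT f) /index_iota subn0.
rewrite subrr => /(_ erefl (lo + r%:Z)); rewrite /g eqxx => E.
apply/oppr_inj; rewrite oppr0 E //; apply/mapP; exists r => //.
by rewrite mem_cat mem_head orbT.
Qed.

Lemma in_degrees_ex x : exists lo r, in_degrees lo r x.
Proof.
have [s [f [fH ->]]] := dsH.1 x.
have [N NP] : exists N : nat, forall i, i \in s -> (`|i| <= N)%N.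
  elim: s => [|i s [N NP]]; first by exists 0%N.
  exists (maxn `|i| N) => j; rewrite inE => /orP[/eqP->|/NP]; first exact: leq_maxl.
  by move=> jN; apply: leq_trans jN (leq_maxr _ _).
exists (- N%:Z), (N + N).+1.
rewrite big_seq; apply: in_degrees_sum => i /NP iN.
apply: (@in_degrees_hom _ _ (absz (i + N%:Z))); first by lia.
by rewrite (_ : - N%:Z + _ = i) //; lia.
Qed.

Variable th : R -> {poly R}.
Hypotheses (thG : forall x i, (th x)`_i \in G i) (thE : forall x, (th x).[1] = x)
  (thU : forall p : {poly R}, (forall i, p`_i \in G i) -> th p.[1] = p).

(* The top component of an annihilator of [x] kills the top component of [x],
   hence a power of it kills [x]. *)
Lemma top_comp_nilpotent a n : (forall i, (n < i)%N -> (th a)`_i = 0) ->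
  forall r lo x, a *: x = 0 -> in_degrees lo r x ->
  exists k, (th a)`_n ^+ k *: x = 0.
Proof.
move=> an; elim=> [|r IH] lo x ax.
  by move=> [f [_ ->]]; exists 0%N; rewrite big_ord0 scaler0.
move=> [f [fH xE]]; set b := (th a)`_n.
have aE : a = \sum_(i < n.+1) (th a)`_i := sum_comp thE an.
have bf : b *: f r = 0.
  apply: (@in_degrees_uniq lo (n + r)); last first.
    by rewrite PoszD addrCA; apply: GH; [apply: thG|apply: fH].
  have -> : b *: f r =
      - ((\sum_(i < n) (th a)`_i) *: x + b *: \sum_(j < r) f j).
    apply/eqP; rewrite -addr_eq0 addrC -addrA -scalerDr.
    rewrite -[_ + f r](big_ord_recr r (fun j => f j)) -xE -scalerDl.
    by rewrite -(big_ord_recr n (fun i => (th a)`_i)) -aE ax.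
  apply/in_degreesN/in_degreesD; rewrite ?xE ?scaler_suml ?scaler_sumr.
    apply: in_degrees_sum => i _; rewrite scaler_sumr.
    apply: in_degrees_sum => j _; apply: (@in_degrees_hom _ _ (i + j)).
      by have := ltn_ord i; have := ltn_ord j; clear; lia.
    by rewrite PoszD addrCA; apply: GH; [apply: thG|apply: fH].
  apply: in_degrees_sum => j _; apply: (@in_degrees_hom _ _ (n + j)).
    by rewrite ltn_add2l.
  by rewrite PoszD addrCA; apply: GH; [apply: thG|apply: fH].
have [||k kx] := IH (lo + n%:Z) (b *: x).
- by rewrite scalerA mulrC -scalerA ax scaler0.
- exists (fun j => b *: f j); split=> [j|].
    by rewrite -addrA addrCA; apply: GH; [apply: thG|apply: fH].
  by rewrite xE big_ord_recr /= scalerDr bf addr0 scaler_sumr.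
by exists k.+1; rewrite exprSr -scalerA.
Qed.

(** A power of the top component of an annihilator kills [x], so this component lies in the prime
    [p]; subtracting it lowers the degree. *)
Lemma ann_prime_graded (p : prime_idealr R) (x : V) :
  (forall a, a *: x = 0 <-> a \in p) -> graded_ideal th (fun a => a \in p).
Proof.
move=> annx a i pa.
have [lo [r xr]] := in_degrees_ex x.
have exp_mem b k : b ^+ k \in p -> b \in p.
  elim: k => [|k IH]; first by rewrite expr0 idealr1.
  by rewrite exprS prime_idealrM => /orP[].
suff comp_mem n : forall a, a \in p -> (forall i, (n <= i)%N -> (th a)`_i = 0) ->
    forall i, (th a)`_i \in p.
  apply: (comp_mem (size (th a))) => // j; exact: nth_default.
elim: n => [|n IH] {pa}a pa a0 {}i; first by rewrite a0 ?rpred0.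
have [k kx] := top_comp_nilpotent a0 ((annx a).2 pa) xr.
have pb : (th a)`_n \in p by apply/(exp_mem _ k)/annx.
have pab j : (th (a - (th a)`_n))`_j \in p.
  apply: IH => [|{}j nj]; first by rewrite rpredB.
  rewrite (compB thG thE thU) coefB (coef_hom thU _ (thG a n)).
  have [->|nen] := eqVneq j n; first by rewrite subrr.
  by rewrite subr0 a0 // ltn_neqAle eq_sym nen.
have := pab i; rewrite (compB thG thE thU) coefB (coef_hom thU _ (thG a n)).
by case: eqP => [-> _ //|_]; rewrite subr0.
Qed.

End GradedModule.

(** * Reordering prime filtrations *)

Section PrimeSeries.
Variables (R : comNzRingType) (V : lmodType R).
Implicit Types (X Y : V -> Prop) (es : seq (V * prime_idealr R)).

Lemma submoduleB X x y : submodule X -> X x -> X y -> X (x - y).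
Proof. by move=> [_ XD XZ] Xx Xy; rewrite -scaleN1r; apply/XD/XZ. Qed.

Definition mod_adj X e x := exists a, X (x - a *: e).

(* [es] lists generators e_1, ..., e_r and primes P_1, ..., P_r such that the
   annihilator of e_i modulo X + R e_1 + ... + R e_(i-1) is P_i. *)
Fixpoint prime_series X es : Prop :=
  if es is (e, P) :: t then
    (forall a, X (a *: e) <-> a \in P) /\ prime_series (mod_adj X e) t
  else True.

Definition series_top X es := foldl (fun Y ep => mod_adj Y ep.1) X es.

Lemma mod_adj_sub X e x : X x -> mod_adj X e x.
Proof. by exists 0; rewrite scale0r subr0. Qed.

Lemma mod_adj_gen X e : submodule X -> mod_adj X e e.
Proof. by case=> X0 _ _; exists 1; rewrite scale1r subrr. Qed.

Lemma mod_adjP X e : submodule X -> submodule (mod_adj X e).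
Proof.
move=> [X0 XD XZ]; split=> [|x y [a Xa] [b Xb]|b x [a Xa]].
- exact: mod_adj_sub.
- by exists (a + b); rewrite scalerDl opprD addrACA; apply: XD.
- by exists (b * a); rewrite -scalerA -scalerBr; apply: XZ.
Qed.

Lemma series_topP X es : submodule X -> submodule (series_top X es).
Proof. by elim: es X => //= ep t IH X subX; apply/IH/mod_adjP. Qed.

Lemma series_top_sub X es x : X x -> series_top X es x.
Proof. by elim: es X => //= ep t IH X Xx; apply/IH/mod_adj_sub. Qed.

Lemma series_top_cat X s t : series_top X (s ++ t) = series_top (series_top X s) t.
Proof. exact: foldl_cat. Qed.

Lemma prime_series_cat X s t :
  prime_series X (s ++ t) <-> prime_series X s /\ prime_series (series_top X s) t.
Proof.
elim: s X => [|[e P] s IH] X /=; first by split=> [|[]].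
by rewrite IH; split=> [[? []]|[[]]].
Qed.

Lemma In_unzip2_cat (A B : Type) (s t : seq (A * B)) b :
  List.In b (unzip2 (s ++ t)) <-> List.In b (unzip2 s) \/ List.In b (unzip2 t).
Proof. by rewrite /unzip2 map_cat; exact: List.in_app_iff. Qed.

Lemma In_unzip2_split (A B : Type) (s : seq (A * B)) b :
  List.In b (unzip2 s) -> exists s1 a s2, s = s1 ++ (a, b) :: s2.
Proof.
elim: s => [//|[a' b'] s IH] /= [->|/IH[s1 [a [s2 ->]]]].
  by exists [::], a', s.
by exists ((a', b') :: s1), a, s2.
Qed.

(** The product of one element outside [p] from each prime of the series moves its top into [X]: the
    quotient vanishes at [p]. *)
Lemma series_kill X es (p : prime_idealr R) : submodule X -> prime_series X es ->
    (forall P, List.In P (unzip2 es) -> exists2 z, z \in P & z \notin p) ->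
  exists2 s, s \notin p & forall x, series_top X es x -> X (s *: x).
Proof.
elim: es X => [|[e P] es IH] X subX /=.
  by move=> _ _; exists 1 => [|x]; rewrite ?idealr1 ?scale1r.
move=> [annP ser] nsub.
have [s nps sX] := IH _ (mod_adjP e subX) ser (fun Q QP => nsub Q (or_intror QP)).
have [z Pz npz] := nsub P (or_introl erefl).
exists (z * s) => [|x /sX[a Xa]]; first by rewrite prime_idealrM negb_or npz.
have [_ XD XZ] := subX.
rewrite -scalerA -(subrK (a *: e) (s *: x)) scalerDr; apply: XD; first exact: XZ.
by rewrite scalerA; apply/annP; rewrite mulrC idealMr.
Qed.

(** The prime belongs to the step where [x] enters: there x = a e modulo the previous term, with [a]
    outside it. *)
Lemma series_first X es x : submodule X -> prime_series X es ->
    series_top X es x -> ~ X x ->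
  exists2 P, List.In P (unzip2 es) & forall s, X (s *: x) -> s \in P.
Proof.
elim: es X => [|[e P] es IH] X subX //= [annP ser] tx nXx.
have [[a Xa]|nadj] := pselect (mod_adj X e x); last first.
  have [Q QP nQ] := IH _ (mod_adjP e subX) ser tx nadj.
  by exists Q; [right|move=> s /(mod_adj_sub e)/nQ].
exists P; first by left.
have [_ XD XZ] := subX.
have Xe b : X (b *: x) -> X ((b * a) *: e).
  move=> Xb; rewrite (_ : _ *: e = b *: x - b *: (x - a *: e)).
    by apply: submoduleB => //; apply: XZ.
  by rewrite -scalerBr opprB addrC subrK scalerA.
move=> s /Xe/annP; rewrite prime_idealrM => /orP[//|/annP Xae].
by case: nXx; rewrite -(subrK (a *: e) x); apply: XD.
Qed.

Lemma series_elem X es P : submodule X -> prime_series X es ->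
    List.In P (unzip2 es) ->
  exists2 x, series_top X es x & forall s, X (s *: x) -> s \in P.
Proof.
move=> subX ser inP; have [s1 [e [s2 E]]] := In_unzip2_split inP; move: ser.
rewrite E prime_series_cat series_top_cat => -[_ [/= annP ser]].
exists e => [|s Xs]; last by apply/annP/series_top_sub.
exact/series_top_sub/mod_adj_gen/series_topP.
Qed.

Fixpoint pretty_seq (l : seq (prime_idealr R)) : Prop :=
  if l is P :: t then (forall Q, List.In Q t -> {subset P <= Q} -> {subset Q <= P})
    /\ pretty_seq t
  else True.

Lemma pretty_seq_cat l l' : pretty_seq (l ++ l') <->
  [/\ pretty_seq l, pretty_seq l' & forall P Q, List.In P l -> List.In Q l' ->
    {subset P <= Q} -> {subset Q <= P}].
Proof.
elim: l => [|P l IH] /=; first by split=> [|[]].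
rewrite IH; split=> [[H [pl pl' cr]]|[[H pl] pl' cr]].
  split=> // [|P' Q [<-|]].
  - by split=> // Q lQ; apply: H; apply/List.in_app_iff; left.
  - by move=> l'Q; apply: H; apply/List.in_app_iff; right.
  - exact: cr.
split; last by split=> // P' Q lP'; apply: cr; right.
by move=> Q /List.in_app_iff[/H //|]; apply: cr; left.
Qed.

(** If no earlier prime is contained in P, a product of elements of the earlier primes outside P
    carries the generator [e] to an element with annihilator exactly P modulo [X]. An earlier prime
    contained in P equals P by prettiness, and its earlier place is used instead. *)
Lemma pretty_series_ass X es P : submodule X -> prime_series X es ->
    pretty_seq (unzip2 es) -> List.In P (unzip2 es) ->
  exists2 x, series_top X es x & forall a, X (a *: x) <-> a \in P.
Proof.
move=> subX ser pr inP.
have [s1 [e [s2 esE]]] := In_unzip2_split inP.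
elim/ltn_ind: {s1}(size s1) {-2}s1 (erefl (size s1)) P e s2 esE inP => n IH
  s1 sz P e s2 esE inP.
have [nsub|] := pselect
  (forall Q, List.In Q (unzip2 s1) -> exists2 z, z \in Q & z \notin P).
  move: ser; rewrite esE prime_series_cat series_top_cat => -[ser1 [/= annP ser]].
  have [s nPs sX] := series_kill subX ser1 nsub.
  have [_ _ YZ] := series_topP s1 subX.
  exists (s *: e) => [|a].
    by apply: series_top_sub; exists s; rewrite subrr; case: (series_topP s1 subX).
  split=> [/(series_top_sub s1)|Pa]; last first.
    by rewrite scalerA mulrC -scalerA; apply/sX/annP.
  by rewrite scalerA => /annP; rewrite prime_idealrM (negPf nPs) orbF.
move=> /existsNP[Q /not_implyP[inQ nQ]].
have sQP : {subset Q <= P}.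
  move=> z Qz; apply: contrapT => /negP nPz.
  by apply: nQ; exists z.
have sPQ : {subset P <= Q}.
  move: pr; rewrite esE /unzip2 map_cat => /pretty_seq_cat[_ _ cr].
  by apply: cr => //; left.
have [t1 [e' [t2 s1E]]] := In_unzip2_split inQ.
have [|||x tx xQ] := IH (size t1) _ t1 erefl Q e' (t2 ++ (e, P) :: s2).
- by rewrite -sz s1E size_cat /= -addSnnS leq_addr.
- by rewrite esE s1E -catA.
- by rewrite esE; apply/In_unzip2_cat; left.
exists x => // a; rewrite xQ; split; [exact: sQP|exact: sPQ].
Qed.

Lemma pred_eq (T : Type) (X Y : T -> Prop) : (forall x, X x <-> Y x) -> X = Y.
Proof. by move=> XY; apply: funext => x; apply: propext. Qed.

Lemma mod_adjC X e e' : mod_adj (mod_adj X e) e' = mod_adj (mod_adj X e') e.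
Proof.
by apply: pred_eq => x; split=> -[a [b Xab]]; exists b, a; rewrite addrAC.
Qed.

(* Adjacent factors R / P, R / Q can be exchanged if all homomorphisms
   Q -> R / P are multiplications, i.e. if Ext^1(R / Q, R / P) = 0. *)
Lemma series_swap X e (P : prime_idealr R) e' (Q : prime_idealr R) : submodule X ->
    (forall a, X (a *: e) <-> a \in P) ->
    (forall a, mod_adj X e (a *: e') <-> a \in Q) ->
    (forall f, hom_mod (fun x => x \in Q) (fun x => x \in P) f ->
       inner_mod (fun x => x \in Q) (fun x => x \in P) f) ->
  exists e'', [/\ forall a, X (a *: e'') <-> a \in Q,
    forall a, mod_adj X e'' (a *: e) <-> a \in P
    & mod_adj (mod_adj X e'') e = mod_adj (mod_adj X e) e'].
Proof.
move=> subX annP annQ inn; have [X0 XD XZ] := subX.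
(* The relation a e' = f(a) e modulo [X], for a in Q, defines the map Q -> R/P that classifies the
   extension of R/Q by R/P. *)
have exf a : exists b, a \in Q -> X (a *: e' - b *: e).
  by have [/annQ[b Xb]|_] := boolP (a \in Q); [exists b|exists 0].
have [f fP] := choice exf.
have [|c fc] := inn f.
  split=> [x y Qx Qy|a x Qx]; apply/annP.
    have -> : (f (x + y) - (f x + f y)) *: e =
        (x *: e' - f x *: e + (y *: e' - f y *: e)) - ((x + y) *: e' - f (x + y) *: e).
      by rewrite scalerBl !scalerDl addrACA -opprD opprB [RHS]addrC addrA subrK.
    by apply: submoduleB => //; [apply: XD; apply: fP|apply: fP; rewrite rpredD].
  have -> : (f (a * x) - a * f x) *: e =
      a *: (x *: e' - f x *: e) - ((a * x) *: e' - f (a * x) *: e).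
    by rewrite scalerBl scalerBr !scalerA opprB [RHS]addrC addrA subrK.
  by apply: submoduleB => //; [apply: XZ; apply: fP|apply: fP; rewrite idealMr].
(* As [f] is multiplication by [c], this correction is killed by Q modulo [X] and splits the
   extension. *)
pose e'' := e' - c *: e.
have e''E a : a *: e' = a *: e'' + (a * c) *: e.
  by rewrite /e'' scalerBr scalerA subrK.
have XQ a : X (a *: e'') <-> a \in Q.
  split=> [Xa|Qa]; first by apply/annQ; exists (a * c); rewrite e''E addrK.
  have -> : a *: e'' = (a *: e' - f a *: e) + (f a - a * c) *: e.
    by rewrite e''E scalerBl addrA subrK addrK.
  by apply: XD; [apply: fP|apply/annP/fc].
exists e''; split=> // [a|].
  split=> [[b Xb]|/annP]; last exact: mod_adj_sub.
  have Qb : b \in Q.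
    apply/annQ; exists (b * c + a).
    rewrite e''E scalerDl opprD addrA addrK.
    by rewrite -opprB -scaleN1r; apply: XZ.
  by apply/annP; rewrite -(subrK (b *: e'') (a *: e)); apply: XD => //; apply/XQ.
rewrite mod_adjC; apply: pred_eq => x; split=> -[a [b Xab]].
  exists a, (b - a * c); rewrite (_ : _ - _ = x - a *: e'' - b *: e) //.
  by rewrite e''E scalerBl opprD opprB !addrA subrK.
exists a, (b + a * c); rewrite (_ : _ - _ = x - a *: e' - b *: e) //.
by rewrite e''E scalerDl !opprD !addrA addrAC.
Qed.

Variable d : prime_idealr R -> nat.

Fixpoint dim_sorted (l : seq (prime_idealr R)) : Prop :=
  if l is P :: t then (forall Q, List.In Q t -> (d P <= d Q)%N) /\ dim_sorted t
  else True.

(** The premise [d Q < d P] confines the condition to pairs that are out of order. *)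
Definition swappable (P Q : prime_idealr R) := (d Q < d P)%N ->
  forall f, hom_mod (fun x => x \in Q) (fun x => x \in P) f ->
            inner_mod (fun x => x \in Q) (fun x => x \in P) f.

Lemma series_insert X e P t : submodule X -> prime_series X ((e, P) :: t) ->
    dim_sorted (unzip2 t) ->
    (forall Q, List.In Q (unzip2 t) -> swappable P Q) ->
  exists es, [/\ prime_series X es, series_top X es = series_top X ((e, P) :: t),
    dim_sorted (unzip2 es)
    & forall Q, List.In Q (unzip2 es) -> P = Q \/ List.In Q (unzip2 t)].
Proof.
elim: t X e => [|[e' Q] t IH] X e subX.
  by move=> ser _ _; exists [:: (e, P)]; split=> // Q [->|[]]; left.
move=> [annP [annQ ser]] [/= leQ st] sw.
have [lePQ|ltQP] := leqP (d P) (d Q).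
  exists ((e, P) :: (e', Q) :: t); split=> //=.
  by split=> // Q' [<- //|/leQ]; apply: leq_trans.
have [e'' [annQ' annP' E]] := series_swap subX annP annQ (sw Q (or_introl erefl) ltQP).
have [||es [ser' topE sorted inP]] := IH (mod_adj X e'') e (mod_adjP _ subX) _ st.
- by split=> //; rewrite E.
- by move=> Q' inQ'; apply: sw; right.
exists ((e'', Q) :: es); split=> //=.
- by rewrite topE /= E.
- by split=> // Q' /inP[<-|/leQ //]; apply: ltnW.
- by move=> Q' [->|/inP[]]; [right; left|left|right; right].
Qed.

(** Insertion sort. When P is contained in a later Q, prettiness gives P = Q and the pair is in
    order; hence [swappable] is asked only for P not contained in Q. *)
Lemma series_sort X es : submodule X -> prime_series X es ->
    (forall P Q : prime_idealr R, P =i Q -> d P = d Q) ->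
    pretty_seq (unzip2 es) ->
    (forall P Q : prime_idealr R, List.In P (unzip2 es) ->
       List.In Q (unzip2 es) -> (exists2 z, z \in P & z \notin Q) -> swappable P Q) ->
  exists es', [/\ prime_series X es', series_top X es' = series_top X es,
    dim_sorted (unzip2 es')
    & forall Q, List.In Q (unzip2 es') -> List.In Q (unzip2 es)].
Proof.
move=> + + dE; elim: es X => [|[e P] es IH] X subX; first by exists [::].
move=> [annP ser] [/= prP pr] sw.
have [|es' [ser' topE sorted inP]] := IH _ (mod_adjP e subX) ser pr.
  by move=> P' Q' inP' inQ'; apply: sw; right.
have serP : prime_series X ((e, P) :: es') by split.
have [Q /inP inQ ltQP|es'' [ser'' topE' sorted' inP']] := series_insert subX serP sorted.
- have [|nz] := pselect (exists2 z, z \in P & z \notin Q).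
    by move=> ex; apply: sw ex ltQP; [left|right].
  have sPQ : {subset P <= Q}.
    move=> z Pz; apply: contrapT => /negP nQz.
    by apply: nz; exists z.
  have sQP := prP Q inQ sPQ.
  rewrite (dE P Q) ?ltnn // in ltQP.
  by move=> z; apply/idP/idP => [/sPQ|/sQP].
exists es''; split=> // [|Q /inP'[->|/inP]]; [|by left|by right].
by rewrite topE' /= topE.
Qed.

Lemma dim_sorted_split es i : dim_sorted (unzip2 es) ->
  exists s1 s2, [/\ es = s1 ++ s2,
    forall P, List.In P (unzip2 s1) -> (d P < i)%N,
    forall P, List.In P (unzip2 s2) -> (i <= d P)%N
    & dim_sorted (unzip2 s2)].
Proof.
elim: es => [|[e P] es IH] /=; first by exists [::], [::].
move=> [leP srt]; have [le|lt] := leqP i (d P).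
  exists [::], ((e, P) :: es); split=> //=.
  by move=> Q [<- //|/leP]; apply: leq_trans.
have [s1 [s2 [esE lt1 le2 srt2]]] := IH srt.
exists ((e, P) :: s1), s2; split=> // [|Q [<- //|/lt1 //]].
by rewrite esE.
Qed.

End PrimeSeries.

(** * Subquotients *)

Section SubquotientSeries.
Variables (R : comNzRingType) (V : lmodType R) (B A : submodClosed V).

Definition subquot_pi (u : submod B) : subquot B A := \pi_(subquot B A) u.

Lemma subquot_piB u v : subquot_pi (u - v) = subquot_pi u - subquot_pi v.
Proof. exact: (raddfB \pi_(subquot B A)). Qed.

Lemma subquot_piZ a u : subquot_pi (a *: u) = a *: subquot_pi u.
Proof. exact: pi_quotmod_scale. Qed.

Lemma subquot_pi_eq u v :
  subquot_pi u = subquot_pi v <-> submod_val u - submod_val v \in A.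
Proof.
rewrite -submod_valB -[_ \in A]/(u - v \in restr_pred A (N := B)).
rewrite -(quotmod_eq (restr_pred A : submodClosed (submod B))).
by split=> [E|/eqP //]; apply/eqP.
Qed.

Lemma subquot_pi_eq0 u : subquot_pi u = 0 <-> submod_val u \in A.
Proof.
have pi0 : subquot_pi 0 = 0 by rewrite -(subrr 0) subquot_piB subrr.
by rewrite -[X in _ = X]pi0 subquot_pi_eq submod_val0 subr0.
Qed.

Lemma subquot_pi_surj (v : subquot B A) : exists u, v = subquot_pi u.
Proof. by exists (repr v); rewrite /subquot_pi reprK. Qed.

(** The dictionary between filtrations and [prime_series]: [e] corresponds to the class of 1. *)
Lemma mod_iso_ideal_quotP (P : prime_idealr R) : {subset A <= B} ->
  mod_iso (subquot B A) {ideal_quot P} <->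
  exists e, (forall x, x \in B <-> mod_adj (fun x => x \in A) e x) /\
            (forall a, a *: e \in A <-> a \in P).
Proof.
move=> sAB; split=> [[f [g fK gK]]|[e [Be annP]]].
  have [u uE] := subquot_pi_surj (g (\pi_{ideal_quot P} 1)).
  have fu a : f (subquot_pi (a *: u)) = \pi_{ideal_quot P} a.
    rewrite subquot_piZ linearZZ -uE gK.
    by rewrite -[LHS]/(\pi_{ideal_quot P} a * \pi 1) -rmorphM mulr1.
  exists (submod_val u); split=> [x|a].
    split=> [Bx|[a Ax]].
      exists (repr (f (subquot_pi (Submod Bx)))); rewrite -submod_valZ.
      rewrite -[x]/(submod_val (Submod Bx)) -subquot_pi_eq.
      by apply: (can_inj fK); rewrite fu reprK.
    rewrite -(subrK (a *: submod_val u) x).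
    by apply: rpredD; [apply: sAB|apply/rpredZ/submod_valP].
  rewrite -submod_valZ -subquot_pi_eq0 -pi_ideal_eq0 -fu.
  split=> [->|E]; first by rewrite linear0.
  by apply: (can_inj fK); rewrite E linear0.
have BeB : e \in B by apply/Be/mod_adj_gen/submodClosed_submodule.
pose w := subquot_pi (Submod BeB).
have wE a : a *: w = 0 <-> a \in P.
  by rewrite -subquot_piZ subquot_pi_eq0 submod_valZ.
have exa (v : subquot B A) : exists a, v = a *: w.
  have [u ->] := subquot_pi_surj v.
  have [a Aa] := (Be _).1 (submod_valP u).
  by exists a; rewrite -subquot_piZ subquot_pi_eq submod_valZ.
have [al alE] := choice exa.
pose f (v : subquot B A) : {ideal_quot P} := \pi_{ideal_quot P} (al v).
have linf : linear f.
  move=> a u v; rewrite -[a *: f u]/(\pi_{ideal_quot P} a * _) -rmorphM -rmorphD.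
  apply/pi_ideal_eq/wE.
  by rewrite scalerBl scalerDl -scalerA -!alE subrr.
pose F : {linear subquot B A -> {ideal_quot P}} :=
  HB.pack f (GRing.isLinear.Build R _ _ _ f linf).
exists F; exists (fun y : {ideal_quot P} => (repr y : R) *: w) => [v|y].
  rewrite [RHS]alE; apply/eqP; rewrite -subr_eq0 -scalerBl; apply/eqP/wE/pi_ideal_eq.
  by rewrite reprK.
rewrite -[RHS]reprK; apply/pi_ideal_eq/wE.
by rewrite scalerBl -alE subrr.
Qed.

Lemma subquot_series (X : V -> Prop) (X' : subquot B A -> Prop) es :
    (forall u, X' (subquot_pi u) <-> X (submod_val u)) ->
    submodule X -> prime_series X es -> (forall x, series_top X es x -> x \in B) ->
  exists es', [/\ prime_series X' es', unzip2 es' = unzip2 es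
    & forall u, series_top X' es' (subquot_pi u) <-> series_top X es (submod_val u)].
Proof.
elim: es X X' => [|[e P] es IH] X X' XX' subX /=; first by exists [::].
move=> [annP ser] topB.
have Be : e \in B by apply/topB/series_top_sub/mod_adj_gen.
have [||es' [ser' E' top']] :=
  IH (mod_adj X e) (mod_adj X' (subquot_pi (Submod Be))) _ _ ser topB.
- move=> u; split=> -[a Xa]; exists a.
    by move: Xa; rewrite -subquot_piZ -subquot_piB XX' submod_valB submod_valZ.
  by rewrite -subquot_piZ -subquot_piB XX' submod_valB submod_valZ.
- exact: mod_adjP.
exists ((subquot_pi (Submod Be), P) :: es'); split=> //=; last by rewrite E'.
by split=> // a; rewrite -annP -subquot_piZ XX' submod_valZ.
Qed.

Lemma series_of_subquot (X : V -> Prop) (X' : subquot B A -> Prop) es' :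
    (forall u, X' (subquot_pi u) <-> X (submod_val u)) ->
    (forall x, X x -> x \in B) -> prime_series X' es' ->
  exists es, [/\ prime_series X es, unzip2 es = unzip2 es',
    forall u, series_top X' es' (subquot_pi u) <-> series_top X es (submod_val u)
    & forall x, series_top X es x -> x \in B].
Proof.
elim: es' X X' => [|[e' P] es' IH] X X' XX' XB /=; first by exists [::].
move=> [annP ser].
have [w wE] := subquot_pi_surj e'; rewrite {}wE in annP ser *.
have [||es [ser' E' top' topB]] :=
  IH (mod_adj X (submod_val w)) (mod_adj X' (subquot_pi w)) _ _ ser.
- move=> u; split=> -[a Xa]; exists a.
    by move: Xa; rewrite -subquot_piZ -subquot_piB XX' submod_valB submod_valZ.
  by rewrite -subquot_piZ -subquot_piB XX' submod_valB submod_valZ.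
- move=> x [a /XB Bx].
  rewrite -(subrK (a *: submod_val w) x).
  by apply: rpredD => //; apply/rpredZ/submod_valP.
exists ((submod_val w, P) :: es); split=> //=; last by rewrite E'.
by split=> // a; rewrite -annP -subquot_piZ XX' submod_valZ.
Qed.

End SubquotientSeries.

Section Filtrations.
Variables (R : comNzRingType) (V : lmodType R).

Lemma zero_submodule : submodule (fun x : V => x = 0).
Proof.
by split=> [//|x y -> ->|a x ->]; rewrite ?addr0 ?scaler0.
Qed.

Lemma filtration_series (F : prime_filtration V) :
  exists es, [/\ prime_series (fun x : V => x = 0) es,
    forall x, series_top (fun x : V => x = 0) es x,
    forall P, List.In P (unzip2 es) -> exists i, pf_prime F i = P
    & pretty_clean_filtration F -> pretty_seq (unzip2 es)].
Proof.
suff H k : (k <= pf_len F)%N -> exists es,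
   [/\ prime_series (fun x : V => x = 0) es,
    forall x, series_top (fun x : V => x = 0) es x <-> x \in pf_sub F k,
    forall P, List.In P (unzip2 es) ->
      exists2 i : 'I_(pf_len F), (i < k)%N & pf_prime F i = P
    & pretty_clean_filtration F -> pretty_seq (unzip2 es)].
  have [es [ser top inP pr]] := H _ (leqnn _).
  exists es; split=> // [x|P /inP[i]]; first by apply/top; rewrite pf_top.
  by exists i.
elim: k => [|k IH] kr.
  by exists [::]; split=> // x; rewrite pf_bot /= inE; split=> /eqP.
have [es [ser top inP pr]] := IH (ltnW kr).
pose i := Ordinal kr.
have [e [topE annP]] := (mod_iso_ideal_quotP _ (@pf_le _ _ F i)).1 (@pf_factor _ _ F i).
have topk : series_top (fun x : V => x = 0) es = fun x => x \in pf_sub F k.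
  exact: pred_eq top.
exists (es ++ [:: (e, pf_prime F i)]); split.
- by apply/prime_series_cat; rewrite topk.
- by move=> x; rewrite series_top_cat topk /= -topE.
- move=> P /In_unzip2_cat[/inP[j jk <-]|[<-|//]]; last by exists i.
  by exists j => //; apply: leq_trans jk (leqnSn k).
move=> prF; rewrite /unzip2 map_cat; apply/pretty_seq_cat; split=> //.
  exact: pr.
move=> P Q /inP[j jk <-] [<-|//] sPQ x.
by rewrite (prF j i jk sPQ).
Qed.

Lemma In_nth (T : Type) (s : seq T) x0 i :
  (i < size s)%N -> List.In (nth x0 s i) s.
Proof.
elim: s i => [//|x s IH] [|i] /= si; first by left.
by right; apply: IH.
Qed.

Lemma pretty_seq_nth l (P0 : prime_idealr R) i j : pretty_seq l ->
  (i < j)%N -> (j < size l)%N -> {subset nth P0 l i <= nth P0 l j} ->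
  {subset nth P0 l j <= nth P0 l i}.
Proof.
elim: l i j => [//|P l IH] i [//|j] /= [prP pr] ij jl.
case: i ij => [_|i ij]; last exact: IH.
exact/prP/In_nth.
Qed.

Lemma series_filtration (es : seq (V * prime_idealr R)) :
    prime_series (fun x : V => x = 0) es ->
    (forall x, series_top (fun x : V => x = 0) es x) ->
  exists F : prime_filtration V,
    (forall i, List.In (pf_prime F i) (unzip2 es)) /\
    (pretty_seq (unzip2 es) -> pretty_clean_filtration F).
Proof.
move=> ser full; pose X i := series_top (fun x : V => x = 0) (take i es).
have subX i : submodule (X i) by apply/series_topP/zero_submodule.
have [N NP] := choice (fun i => submodule_submodClosed (subX i)).
(* The list may be empty and no default prime is at hand, so the entry at a valid index is fixed
   independently of any default. *)
have exep (i : 'I_(size es)) : exists p, forall p0, p = nth p0 es i.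
  case: (es) i => [[]//|p t] i; exists (nth p (p :: t) i) => p0.
  exact: set_nth_default.
have [ep epE] := choice exep.
have nthE ep0 i : ep i = nth ep0 es i by apply: epE.
have step (i : 'I_(size es)) :
    X i.+1 = mod_adj (X i) (ep i).1 /\
    forall a, X i (a *: (ep i).1) <-> a \in (ep i).2.
  rewrite /X (take_nth (ep i)) // -nthE -cats1 series_top_cat; split=> //.
  move: ser; rewrite -[es in prime_series _ es](cat_take_drop i) (drop_nth (ep i)) //.
  by rewrite -nthE => /prime_series_cat[_]; case: (ep i) => ? ? [].
have bot : N 0%N =i pred1 0.
  by move=> x; rewrite inE; apply/idP/eqP => [/NP|E]; rewrite ?E ?rpred0 // /X take0.
have top : N (size es) =i predT.
  by move=> x; apply/NP; rewrite /X take_size.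
have le (i : 'I_(size es)) : {subset N i <= N i.+1}.
  by move=> x /NP Xx; apply/NP; rewrite (step i).1; apply: mod_adj_sub.
have XN i : (fun x => is_true (x \in N i)) = X i by apply: pred_eq => x; apply: NP.
have factor (i : 'I_(size es)) :
    mod_iso (subquot (N i.+1) (N i)) {ideal_quot (ep i).2}.
  apply/mod_iso_ideal_quotP; first exact: le.
  exists (ep i).1; rewrite XN -(step i).1; split=> [x|a]; first exact: NP.
  by rewrite -(step i).2; apply: NP.
exists (PrimeFiltration bot top le factor); split=> [i|pr i j ij sij x] /=.
  rewrite /= (nthE (ep i)) -(nth_map _ (ep i).2) ?size_map //.
  by apply: In_nth; rewrite size_map.
apply/idP/idP; first exact: sij.
have [p0 nthE2] : exists p0, forall k, (ep k).2 = nth p0 (unzip2 es) k.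
  by exists (ep i).2 => k; rewrite (nthE (ep i)) -(nth_map _ (ep i).2).
move: sij; rewrite /= !nthE2 => sij.
by apply: (pretty_seq_nth pr ij _ sij); rewrite size_map.
Qed.

End Filtrations.

(** * The dimension filtration *)

Lemma strict_chain_subset (R : comNzRingType) (c : nat -> prime_idealr R) k i :
    (forall i, (i < k)%N -> {subset c i <= c i.+1} /\ ~ (c i =i c i.+1)) ->
  (i <= k)%N -> {subset c 0%N <= c i}.
Proof.
move=> cS; elim: i => [_ x //|i IH ik x /(IH (ltnW ik))].
exact: (cS i ik).1.
Qed.

Section Support.
Variables (R : comNzRingType) (V : lmodType R).
Implicit Types (N : submodClosed V) (p P : prime_idealr R).

Lemma in_supp_submod N p : in_supp (submod N) p <->
  exists2 x, x \in N & forall s, s \notin p -> s *: x != 0.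
Proof.
split=> [[u pu]|[x Nx px]].
  exists (submod_val u) => [|s /pu]; first exact: submod_valP.
  apply: contra => /eqP su; apply/eqP/val_inj.
  by rewrite [LHS]submod_valZ su [RHS]submod_val0.
exists (Submod Nx) => s /px; apply: contra => /eqP su.
by rewrite -[x]/(submod_val (Submod Nx)) -submod_valZ su submod_val0.
Qed.

Lemma dim_chain_above N y P i k : y \in N -> (forall s, s *: y = 0 -> s \in P) ->
  dim_le (submod N) i -> chain_above (fun x => x \in P) k -> (k <= i)%N.
Proof.
move=> Ny annP dimN [c [c0 cS]]; apply: (dimN c); split=> // j jk.
apply/in_supp_submod; exists y => // s; apply: contra => /eqP/annP Ps.
exact/(strict_chain_subset cS jk)/c0.
Qed.

(** Supp N lies in the union of Supp A and V(P): if a chain does not start above [P], an element of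
    [P] outside its first prime moves [x] into [A] without killing it at the primes of the chain. *)
Lemma dim_le_adj (A N : submodClosed V) y P i :
    (forall x, x \in N <-> mod_adj (fun x => x \in A) y x) ->
    (forall a, a \in P -> a *: y \in A) ->
    dim_le (submod A) i -> (forall k, chain_above (fun x => x \in P) k -> (k <= i)%N) ->
  dim_le (submod N) i.
Proof.
move=> NE Py dimA dimP c k [csupp cS].
have [sP0|/not_subsetP[z Pz nz]] := pselect ({subset P <= c 0%N}).
  by apply: dimP; exists c.
apply: (dimA c); split=> // j jk; apply/in_supp_submod.
have /in_supp_submod[x /NE[a Ax] x0] := csupp 0%N (leq0n k).
exists (z *: x) => [|s ns].
  rewrite -(subrK (a *: y) x) scalerDr.
  apply: rpredD; first exact: rpredZ.
  by rewrite scalerA mulrC -scalerA; apply/rpredZ/Py.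
rewrite scalerA x0 // prime_idealrM negb_or nz andbT.
by apply: contra ns; apply: (strict_chain_subset cS jk).
Qed.

Variable D : nat -> submodClosed V.
Hypothesis D_dim : dimension_filtration D.

Definition dim_prev i : submodClosed V := if i is j.+1 then D j else zero_submod V.

Lemma dim_prev_sub i : {subset dim_prev i <= D i}.
Proof.
case: i => [|j] x /=; first by move=> /eqP ->; rewrite rpred0.
apply: (D_dim j.+1).2 => c k ch; apply: leqW; exact: (D_dim j).1 ch.
Qed.

Lemma dim_factor_prime i y P : y \in D i ->
    (forall a, a *: y \in dim_prev i <-> a \in P) ->
  chain_above (fun x => x \in P) i /\
  forall k, chain_above (fun x => x \in P) k -> (k <= i)%N.
Proof.
move=> Dy annP; split=> [|k]; last first.
  apply: (dim_chain_above Dy _ (D_dim i).1) => s sy.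
  by apply/annP; rewrite sy rpred0.
case: i Dy annP => [|j] Dy annP; first exact: chain_above0.
(* Without j + 1 steps above [P], adding [y] to [D j] keeps the dimension at most [j]; then y is in
   [D j] and 1 in [P]. *)
apply: contrapT => nch.
have [N NE] := submodule_submodClosed
  (mod_adjP y (submodClosed_submodule (D j))).
have : y \in D j.
  apply: ((D_dim j).2 N); last exact/NE/mod_adj_gen/submodClosed_submodule.
  apply: (dim_le_adj NE (P := P) _ (D_dim j).1) => [a /annP //|k ch].
  by rewrite leqNgt; apply/negP => /chain_above_le/(_ ch).
by rewrite -[y]scale1r => /annP; rewrite idealr1.
Qed.

Lemma clean_factor_series i :
    (nonzero_mod (dim_factor D i) -> clean (dim_factor D i)) ->
  exists es, [/\ prime_series (fun x => x \in dim_prev i) es,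
    forall x, series_top (fun x => x \in dim_prev i) es x <-> x \in D i,
    pretty_seq (unzip2 es)
    & forall P, List.In P (unzip2 es) -> chain_above (fun x => x \in P) i /\
        forall k, chain_above (fun x => x \in P) k -> (k <= i)%N].
Proof.
have piE : forall u : submod (D i), subquot_pi (dim_prev i) u = 0 <->
    submod_val u \in dim_prev i by exact: subquot_pi_eq0.
have [nz|z] := pselect (nonzero_mod (dim_factor D i)); last first.
  move=> _; exists [::]; split=> // x; split=> [|Dx]; first exact: dim_prev_sub.
  apply: (piE (Submod Dx)).1; apply: contrapT => nx; apply: z.
  by exists (subquot_pi (dim_prev i) (Submod Dx)); apply/eqP.
move=> /(_ nz)[F cleanF].
(* Clean implies pretty clean, as comparable minimal primes are equal. *)
have prF : pretty_clean_filtration F.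
  by move=> j k jk sjk; apply: (cleanF k).2 sjk; apply: (cleanF j).1.
have [es' [ser' top' _ /(_ prF) pr']] := filtration_series F.
have [es [ser E top topD]] := series_of_subquot piE (@dim_prev_sub i) ser'.
rewrite -E in pr'; exists es; split=> // [x|P inP].
  by split=> [/topD //|Dx]; apply/(top (Submod Dx))/top'.
have [y ty annP] :=
  pretty_series_ass (submodClosed_submodule (dim_prev i)) ser pr' inP.
exact: (dim_factor_prime (topD _ ty) annP).
Qed.

Lemma dim_factors_clean_pretty_clean :
  finite_dim V -> dim_factors_clean D -> pretty_clean V.
Proof.
move=> [n dimV] cleanD.
have H i : exists es, [/\ prime_series (fun x : V => x = 0) es,
    forall x, series_top (fun x : V => x = 0) es x <-> x \in dim_prev i,
    pretty_seq (unzip2 es)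
    & forall P, List.In P (unzip2 es) -> exists2 j, (j < i)%N &
        forall k, chain_above (fun x => x \in P) k -> (k <= j)%N].
  elim: i => [|i [es [ser top pr dimP]]].
    by exists [::]; split=> // x; split=> /eqP.
  have [es' [ser' top' pr' dimP']] := clean_factor_series (cleanD i).
  have topE := pred_eq top.
  exists (es ++ es'); split.
  - by apply/prime_series_cat; rewrite topE.
  - by move=> x; rewrite series_top_cat topE.
  - rewrite /unzip2 map_cat; apply/pretty_seq_cat; split=> // P Q inP inQ sPQ.
    (* A strict inclusion of P in Q would give i + 1 steps above P, against dim R/P <= j < i. *)
    apply: contrapT => /not_subsetP[z Qz nPz].
    have [j ji /(_ i.+1) dimPj] := dimP _ inP; have [chQ _] := dimP' _ inQ.
    have := dimPj (chain_above_cons (p := P) sPQ Qz nPz chQ).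
    by rewrite leqNgt ltnS ltnW.
  - move=> P /In_unzip2_cat[/dimP[j ji dimPj]|/dimP'[_ dimPi]].
      by exists j => //; apply: leqW.
    by exists i.
have [es [ser top pr _]] := H n.+1.
have [|F [_ prF]] := series_filtration ser; last by exists F; apply: prF.
have [N NE] := submodule_submodClosed (And3 Logic.I (fun _ _ _ _ => Logic.I)
  (fun _ _ _ => Logic.I) : submodule (fun _ : V => True)).
move=> x; apply/top; apply: ((D_dim n).2 N); last exact/NE.
move=> c k [csupp cS]; apply: (dimV c); split=> // i /csupp/in_supp_submod[y _ py].
by exists y.
Qed.

Variable d : prime_idealr R -> nat.
Hypothesis dP : forall P k, chain_above (fun x => x \in P) k <-> (k <= d P)%N.

(** Every prime in the support of the top of [s1] contains a prime of [s1], so the dimension is at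
    most [i]. An element outside this top has its annihilator inside a prime of [s2], so it
    generates a module of dimension above [i]. *)
Lemma dim_submod_series s1 s2 i :
    prime_series (fun x : V => x = 0) (s1 ++ s2) ->
    (forall x, series_top (fun x : V => x = 0) (s1 ++ s2) x) ->
    (forall P, List.In P (unzip2 s1) -> (d P <= i)%N) ->
    (forall P, List.In P (unzip2 s2) -> (i < d P)%N) ->
  forall x, series_top (fun x : V => x = 0) s1 x <-> x \in D i.
Proof.
rewrite prime_series_cat series_top_cat => -[ser1 ser2] full le1 lt2 x.
have sub0 := zero_submodule V; have sub1 := series_topP s1 sub0.
split=> [tx|Dx].
  have [N NE] := submodule_submodClosed sub1.
  apply: ((D_dim i).2 N); last exact/NE.
  move=> c k [csupp cS].
  have /in_supp_submod[y /NE ty y0] := csupp 0%N (leq0n k).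
  have [nsub|/existsNP[P /not_implyP[inP nP]]] := pselect
    (forall P, List.In P (unzip2 s1) -> exists2 z, z \in P & z \notin c 0%N).
    have [s ns s0] := series_kill sub0 ser1 nsub.
    by have := y0 s ns; rewrite (s0 y ty) eqxx.
  apply: leq_trans (le1 P inP); apply/dP; exists c; split=> // z Pz.
  by apply: contrapT => /negP nz; apply: nP; exists z.
apply: contrapT => ntx.
have [P inP annP] := series_first sub1 ser2 (full x) ntx.
have := lt2 P inP; rewrite ltnNge => /negP; apply.
apply: (dim_chain_above Dx _ (D_dim i).1) (_ : chain_above (fun x => x \in P) _).
  by move=> s sx; apply: annP; rewrite sx; case: sub1.
exact/dP.
Qed.

Lemma sorted_series_factors_clean es : prime_series (fun x : V => x = 0) es ->
    (forall x, series_top (fun x : V => x = 0) es x) ->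
    dim_sorted d (unzip2 es) ->
  dim_factors_clean D.
Proof.
move=> ser full srt i _.
(* The series is cut into the primes of dimension below [i], equal to [i] and above [i]. *)
have [s1 [s23 [esE lt1 le23 srt23]]] := dim_sorted_split i srt.
have [s2 [s3 [E23 lt2 le3 _]]] := dim_sorted_split i.+1 srt23.
have top1 x : series_top (fun x : V => x = 0) s1 x <-> x \in dim_prev i.
  case: i lt1 le23 lt2 le3 => [|i] lt1 le23 lt2 le3 /=.
    have -> : s1 = [::] by case: (s1) lt1 => [//|[e P] t] /(_ P (or_introl erefl)).
    by split=> /eqP.
  by apply: (@dim_submod_series s1 s23); rewrite -?esE.
have top2 x : series_top (fun x : V => x = 0) (s1 ++ s2) x <-> x \in D i.
  apply: (@dim_submod_series _ s3); rewrite -?catA -?E23 -?esE //.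
  move=> P /In_unzip2_cat[/lt1/ltnW //|/lt2].
  by rewrite ltnS.
have d2 P : List.In P (unzip2 s2) -> d P = i.
  move=> inP; apply/eqP; rewrite eqn_leq -ltnS lt2 // le23 // E23.
  by apply/In_unzip2_cat; left.
have ser2 : prime_series (fun x => x \in dim_prev i) s2.
  move: ser; rewrite esE E23 => /prime_series_cat[_ /prime_series_cat[]].
  by rewrite (pred_eq top1).
have top2' x : series_top (fun x => x \in dim_prev i) s2 x <-> x \in D i.
  by rewrite -top2 series_top_cat (pred_eq top1).
have piE : forall u : submod (D i), subquot_pi (dim_prev i) u = 0 <->
    submod_val u \in dim_prev i by exact: subquot_pi_eq0.
have [es' [ser' E' top']] :=
  @subquot_series _ _ (D i) (dim_prev i) _ (fun x => x = 0) _ piE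
  (submodClosed_submodule (dim_prev i)) ser2 (fun x => (top2' x).1).
have full' (v : dim_factor D i) : series_top (fun x => x = 0) es' v.
  by have [u ->] := subquot_pi_surj v; apply/top'/top2'/submod_valP.
have [F [inF _]] := series_filtration ser' full'.
have sub0 := zero_submodule (dim_factor D i).
exists F => j; have inP := inF j; move: (pf_prime F j) inP => P inP.
split=> [|q [v qv] sqP].
  have [v _ annP] := series_elem sub0 ser' inP.
  by exists v => s; apply: contra => /eqP/annP.
(* Being in the support, [q] contains some Q of the middle part; Q and P both have dimension [i], so
   Q inside q inside P forces equality. *)
have [nsub|/existsNP[Q /not_implyP[inQ nQ]]] := pselect
    (forall P, List.In P (unzip2 es') -> exists2 z, z \in P & z \notin q).
  have [s ns s0] := series_kill sub0 ser' nsub.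
  by have := qv s ns; rewrite (s0 v (full' v)) eqxx.
have sQq : {subset Q <= q}.
  by move=> z Qz; apply: contrapT => /negP nz; apply: nQ; exists z.
rewrite E' in inP inQ.
have sPQ : {subset P <= Q}.
  apply: contrapT => /not_subsetP[z Pz nQz].
  have : chain_above (fun x => x \in Q) i.+1.
    apply: (chain_above_cons (I := fun x => x \in P) _ Pz nQz).
      by move=> x /sQq/sqP.
    by apply/dP; rewrite d2.
  by move=> /dP; rewrite d2 // ltnn.
by move=> x; apply/idP/idP => [/sqP //|/sPQ/sQq].
Qed.

End Support.

(** * Part (ii): exchangeability of factors, local and graded cases *)

Lemma cohen_macaulay_swappable (R : comNzRingType) (m P Q : prime_idealr R)
    (d : prime_idealr R -> nat) z :
    acc R -> maximal_ideal m -> {subset P <= m} ->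
    (forall (P : prime_idealr R) k,
       chain_above (fun x => x \in P) k <-> (k <= d P)%N) ->
    cohen_macaulay {ideal_quot P} -> chain_to (fun x => x \in P) (d P) m ->
    (forall y t f, y \in Q -> y \notin P -> t \notin m ->
       hom_mod (fun x => x \in Q) (fun x => x \in P) f ->
       inner_mod (fun x => x \in Q) (fun x => x \in P) (fun x => t * f x) ->
       inner_mod (fun x => x \in Q) (fun x => x \in P) f) ->
    z \in P -> z \notin Q ->
  swappable d P Q.
Proof.
move=> accR maxm sPm dE CM [c [sPc cS scm]] desc Pz nQz ltQP f homf.
have [y Qy nPy] : exists2 y, y \in Q & y \notin P.
  apply: not_subsetP => sQP; move: ltQP; rewrite ltnNge => /negP; apply.
  by apply/dE; apply: (chain_above_sub sQP); apply/dE.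
have [S [psi [locS [m' [locm' [n [depthS [dimS _]]]]]]]] :=
  cohen_macaulay_quot_localization maxm sPm CM.
have dn := localization_dim sPm locS dimS sPc scm cS.
have nch : ~ chain_above (fun x => x \in Q) (d P).
  by move=> /dE; rewrite leqNgt ltQP.
have [t nt inn] :=
  localization_inner accR locS locm' depthS dn nch Qy nPy Pz nQz homf.
exact: desc Qy nPy nt homf inn.
Qed.

Lemma dimension_of_primes (R : comNzRingType) n : dim_le (R^o : lmodType R) n ->
  exists d : prime_idealr R -> nat,
    forall (P : prime_idealr R) k,
      chain_above (fun x => x \in P) k <-> (k <= d P)%N.
Proof.
move=> dimR.
have bound (P : prime_idealr R) k : chain_above (fun x => x \in P) k -> (k <= n)%N.
  move=> [c [_ cS]]; apply: (dimR c); split=> // i _.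
  exists 1 => s; apply: contra => /eqP s0.
  by rewrite -(mulr1 s) [s * 1]s0 rpred0.
suff H (P : prime_idealr R) :
    exists d, forall k, chain_above (fun x => x \in P) k <-> (k <= d)%N.
  by have [d dE] := choice H; exists d.
have ex : exists k, `[< chain_above (fun x => x \in P) k >].
  by exists 0%N; apply/asboolP/chain_above0.
have bd k : `[< chain_above (fun x => x \in P) k >] -> (k <= n)%N.
  by move=> /asboolP/bound.
exists (ex_maxn ex bd) => k; case: ex_maxnP => j /asboolP chj maxj.
by split=> [ch|kj]; [apply/maxj/asboolP|apply: chain_above_le kj chj].
Qed.

Lemma local_chain_to (R : comNzRingType) (m P : prime_idealr R) e :
    acc R -> is_local m -> chain_above (fun x => x \in P) e ->
  chain_to (fun x => x \in P) e m.
Proof.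
move=> accR [_ um] [c [sPc cS]]; exists c; split=> // x cx.
have [|n [maxn sn]] := sub_maximal accR (prime_ideal (c e)).
  by rewrite idealr1.
by rewrite -(um n maxn); apply: sn.
Qed.

Lemma unit_inner (R : comNzRingType) (I Z : R -> Prop) u t f :
    ideal Z -> u * t = 1 -> inner_mod I Z (fun x => t * f x) -> inner_mod I Z f.
Proof.
move=> idZ ut [n fn]; exists (u * n) => x /fn Zx.
apply: (ideal_lin1 (a := u) idZ Zx).
by transitivity (u * t * f x - x * (u * n)); [rewrite ut mul1r|ring].
Qed.

(** Shared by both cases, which differ in how they provide [chains] (dim R/P is the height of m/P)
    and [desc] (clearing a denominator). These are asked only for annihilators of elements of [V],
    since in the graded case such primes are known to be graded. *)
Lemma pretty_clean_dim_factors_clean (R : comNzRingType) (V : lmodType R)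
    (D : nat -> submodClosed V) (F : prime_filtration V) (m : prime_idealr R) n :
    acc R -> dimension_filtration D -> maximal_ideal m ->
    dim_le (R^o : lmodType R) n -> pretty_clean_filtration F ->
    (forall i, cohen_macaulay {ideal_quot (pf_prime F i)}) ->
    (forall (P : prime_idealr R) (x : V) e, (forall a, a *: x = 0 <-> a \in P) ->
       chain_above (fun x => x \in P) e -> chain_to (fun x => x \in P) e m) ->
    (forall (P Q : prime_idealr R) (x x' : V) y t f, (forall a, a *: x = 0 <-> a \in P) ->
       (forall a, a *: x' = 0 <-> a \in Q) ->
       y \in Q -> y \notin P -> t \notin m ->
       hom_mod (fun x => x \in Q) (fun x => x \in P) f ->
       inner_mod (fun x => x \in Q) (fun x => x \in P) (fun x => t * f x) ->
       inner_mod (fun x => x \in Q) (fun x => x \in P) f) ->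
  dim_factors_clean D.
Proof.
move=> accR D_dim maxm dimR prF CM chains desc.
have [d dE] := dimension_of_primes dimR.
have [es [ser full inF /(_ prF) pr]] := filtration_series F.
have sub0 := zero_submodule V.
have ass P : List.In P (unzip2 es) -> exists x : V, forall a, a *: x = 0 <-> a \in P.
  by move=> /(pretty_series_ass sub0 ser pr)[x _ annP]; exists x.
have [||es' [ser' top' srt _]] := @series_sort _ _ d _ _ sub0 ser _ pr.
- have sub_d (P Q : prime_idealr R) : P =i Q -> (d P <= d Q)%N.
    move=> PQ; apply/dE; apply: (chain_above_sub (I := fun x => x \in P)).
      by move=> x; rewrite PQ.
    exact/dE.
  move=> P Q PQ; apply/eqP; rewrite eqn_leq !sub_d //.
- move=> P Q inP inQ [z Pz nQz].
  have [x annx] := ass P inP; have [x' annx'] := ass Q inQ.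
  (* A chain of length 0 to [m] shows that P is contained in [m]. *)
  have [c [sPc _ scm]] := chains P x 0%N annx (chain_above0 P).
  apply: (cohen_macaulay_swappable accR maxm _ dE) Pz nQz.
  + by move=> w /sPc/scm.
  + by have [i <-] := inF P inP.
  + by apply: chains annx _; apply/dE.
  + by move=> y t f; apply: (desc P Q x x').
apply: (sorted_series_factors_clean D_dim dE ser' _ srt) => x.
by rewrite top'.
Qed.

Lemma local_dim_factors_clean (R : comNzRingType) (V : lmodType R)
    (D : nat -> submodClosed V) (F : prime_filtration V) (m : prime_idealr R) n :
    acc R -> dimension_filtration D -> is_local m ->
    dim_le (R^o : lmodType R) n -> pretty_clean_filtration F ->
    (forall i, cohen_macaulay {ideal_quot (pf_prime F i)}) ->
  dim_factors_clean D.
Proof.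
move=> accR D_dim locm dimR prF CM.
apply: (pretty_clean_dim_factors_clean accR D_dim locm.1 dimR prF CM).
  by move=> P _ e _; apply: local_chain_to.
move=> P Q _ _ _ t f _ _ _ _ nt _.
have [u ut] := local_unit accR locm nt.
exact: unit_inner (prime_ideal P) ut.
Qed.

Lemma graded_dim_factors_clean (K : fieldType) (R : comNzRingType)
    (iota : {rmorphism K -> R}) (G : nat -> zmodClosed R) (V : lmodType R)
    (D : nat -> submodClosed V) (F : prime_filtration V) (m : prime_idealr R) n :
    acc R -> dimension_filtration D -> standard_graded iota G ->
    graded_module G V -> irrelevant_ideal G m ->
    dim_le (R^o : lmodType R) n -> pretty_clean_filtration F ->
    (forall i, cohen_macaulay {ideal_quot (pf_prime F i)}) ->
  dim_factors_clean D.
Proof.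
move=> accR D_dim [dsG GM G0 _] [H [dsH GH]] irr dimR prF CM.
have [th [thG thE thU]] := direct_sum_poly dsG.
have G1 : 1 \in G 0%N by apply/G0; exists 1; rewrite rmorph1.
have G0_unit x : x \in G 0%N -> x != 0 -> exists y, y * x = 1.
  move=> /G0[a ->] a0; exists (iota a^-1); rewrite -rmorphM mulVf ?rmorph1 //.
  by apply: contraNneq a0 => ->; rewrite rmorph0.
have m_irr x : (th x)`_0 = 0 -> x \in m.
  move=> x0; apply/irr.
  exists [seq i.+1 | i <- seq.iota 0 (size (th x))], (fun i => (th x)`_i).
  split=> //; first by apply/allP => _ /mapP[i _ ->].
  rewrite [LHS](@sum_comp _ _ thE x (size (th x)).+1); last first.
    by move=> i si; rewrite nth_default // ltnW.
  rewrite big_ord_recl x0 add0r big_map.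
  by rewrite -(big_mkord xpredT (fun i => (th x)`_i.+1)) /index_iota subn0.
have gr (P : prime_idealr R) (x : V) : (forall a, a *: x = 0 <-> a \in P) ->
    graded_ideal th (fun x => x \in P).
  exact: (ann_prime_graded dsH GH thG thE thU).
apply: (pretty_clean_dim_factors_clean accR D_dim _ dimR prF CM).
- exact: (irrelevant_maximal thG thE thU m_irr G0_unit).
- move=> P x e /gr grP.
  exact: (graded_chain_to G1 GM thG thE thU m_irr G0_unit grP).
- move=> P Q x x' y t f /gr grP /gr grQ.
  exact: (graded_inner G1 GM thG thE thU m_irr G0_unit grP grQ).
Qed.

Theorem corollary4p2 (R : comNzRingType) (M : lmodType R)
    (D : nat -> submodClosed M)
    (R_noeth : noetherian R) (M_fg : fin_gen M)
    (D_dim : dimension_filtration D) :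
  (finite_dim M -> dim_factors_clean D -> pretty_clean M) /\
  (cohen_macaulay R ->
   (exists m : prime_idealr R, is_local m /\
      exists W : lmodType R, canonical_module_local m W) \/
   (exists (K : fieldType) (iota : {rmorphism K -> R})
      (G : nat -> zmodClosed R), standard_graded iota G /\
      (exists W : lmodType R, canonical_module_graded G W) /\
      graded_module G M) ->
   (exists F : prime_filtration M, pretty_clean_filtration F /\
      forall i, cohen_macaulay {ideal_quot (pf_prime F i)}) ->
   dim_factors_clean D).
Proof.
split; first exact: dim_factors_clean_pretty_clean.
have accR := noetherian_acc R_noeth.
move=> _ + [F [prF CM]].
(* The value of dim R recorded with the canonical module bounds all chains of primes, so that dim
   R/P is a natural number. *)
case=> [[m [locm [W [_ _ [n [_ _ [dimR _] _]]]]]]|].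
  exact: local_dim_factors_clean accR D_dim locm dimR prF CM.
move=> [K [iota [G [stG [[W [_ _ [m [n [irr [dimR _] _]]]]] grM]]]]].
exact: graded_dim_factors_clean accR D_dim stG grM irr dimR prF CM.
Qed.
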